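(* Let $A=\begin{pmatrix} a_{11} & a_{12} \\ a_{21} & a_{22} \end{pmatrix}\in M_2(\mathbb{R})$ satisfy $\det A>0$ and $\mathrm{tr}A<0$, and let $d>0$. Then $$a_{22}+d\,a_{11}>2\sqrt{d\det A}$$ holds if and only if there exists a number $L_0>0$ for which the index of $[\delta,L_0]\times[0,\lambda_\infty]$ is (defined and) nonzero.
   Context: Let $D=\mathrm{diag}(1,d)$ and consider on $\mathbb{R}^4$ the system $$\frac{d}{dx}\begin{pmatrix} v \\ w \end{pmatrix}=\begin{pmatrix} 0 & I \\ D^{-1}(\lambda I-A) & 0 \end{pmatrix}\begin{pmatrix} v \\ w \end{pmatrix},\qquad v,w\in\mathbb{R}^2,$$ with Dirichlet boundary conditions. For $x\ge0$, $\lambda\ge0$ let $W(x,\lambda)\in Gr_2(\mathbb{R}^4)$ be the space of values $(v(x),w(x))$ of solutions with $v(0)=0$, and let $P_D=\{(0,p):p\in\mathbb{R}^2\}$. With $e_1^*,\dots,e_4^*$ the standard dual basis of $\mathbb{R}^4$, put $\omega_1=e_1^*\wedge e_2^*$ (whose kernel is $P_D$) and $\omega_2=e_1^*\wedge e_4^*-e_2^*\wedge e_3^*$. Let $\mathcal{M}\subseteq Gr_2(\mathbb{R}^4)$ be the set of planes $\mathrm{span}\{u_1,u_2\}$ with $(\omega_1(u_1,u_2),\omega_2(u_1,u_2))\neq(0,0)$, and $\phi\colon\mathcal{M}\to\mathbb{R}P^1$, $\phi(\mathrm{span}\{u_1,u_2\})=[\omega_1(u_1,u_2):\omega_2(u_1,u_2)]$.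 Let $\tau\colon\mathbb{R}P^1\to S^1$, $\tau([x:y])=\big(\frac{x-iy}{|x-iy|}\big)^2$. For $L>0$, $\lambda_\infty>0$ denotes a number such that $W(x,\lambda)\cap P_D=\{0\}$ for all $0<x\le L$, $\lambda\ge\lambda_\infty$, and $\delta>0$ is a sufficiently small number, so that $W(x,\lambda)\cap P_D=\{0\}$ for all $0<x\le\delta$, $\lambda\in[0,\lambda_\infty]$ (such numbers exist). The index $\mathfrak{m}$ of $[\delta,L]\times[0,\lambda_\infty]$ is defined if $W$ maps the boundary of this rectangle into $\mathcal{M}$, and is then the winding number (degree) of $\tau\circ\phi\circ W$ along the boundary oriented counterclockwise in the $(x,\lambda)$-plane. *)

(* Defs.v *)
From HB Require Import structures.
From mathcomp Require Import all_boot all_order all_algebra.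
From mathcomp Require Import complex.
From mathcomp Require Import all_classical all_reals all_analysis.
From mathcomp Require Import ring lra.

Set Implicit Arguments.
Unset Strict Implicit.
Unset Printing Implicit Defensive.

Import Order.TTheory GRing.Theory Num.Theory.
Import numFieldNormedType.Exports.

Local Open Scope classical_set_scope.
Local Open Scope ring_scope.

Section Defs.
Variable R : realType.

(* R^4 is written 'cV[R]_(2 + 2), a column (v, w) with v = usubmx and
   w = dsubmx. *)

Definition diffusion (d : R) : 'M[R]_2 :=
  diag_mx (\row_(j < 2) if j == 0 then 1 else d).

Definition system_mx (A : 'M[R]_2) (d lam : R) : 'M[R]_(2 + 2) :=
  block_mx 0 1%:M (invmx (diffusion d) *m (lam%:M - A)) 0.

(* The system is linear with constant coefficients, so solutions on [0, +oo[
   are the restrictions of the solutions on the whole line. *)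
Definition solution (A : 'M[R]_2) (d lam : R) (u : R -> 'cV[R]_(2 + 2)) : Prop :=
  forall x : R, is_derive x 1 u (system_mx A d lam *m u x).

Definition solution_values (A : 'M[R]_2) (d x lam : R) : set 'cV[R]_(2 + 2) :=
  [set u x | u in [set u | solution A d lam u /\ usubmx (u 0) = 0]].

(* W is the subspace whose elements are the solution values: see mem_W. *)
Definition W (A : 'M[R]_2) (d x lam : R) : {vspace 'cV[R]_(2 + 2)} :=
  xget 0%VS [set U : {vspace 'cV[R]_(2 + 2)} |
    forall z, z \in U <-> solution_values A d x lam z].

Definition PD : {vspace 'cV[R]_(2 + 2)} :=
  limg (linfun (fun p : 'cV[R]_2 => col_mx 0 p)).

(* e_i^* /\ e_j^*, with indices counted from 0. *)
Definition dual_wedge (i j : 'I_(2 + 2)) (u1 u2 : 'cV[R]_(2 + 2)) : R :=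
  u1 i 0 * u2 j 0 - u1 j 0 * u2 i 0.

Let o0 : 'I_(2 + 2) := @Ordinal 4 0 isT.
Let o1 : 'I_(2 + 2) := @Ordinal 4 1 isT.
Let o2 : 'I_(2 + 2) := @Ordinal 4 2 isT.
Let o3 : 'I_(2 + 2) := @Ordinal 4 3 isT.

Definition omega1 (u1 u2 : 'cV[R]_(2 + 2)) : R := dual_wedge o0 o1 u1 u2.
Definition omega2 (u1 u2 : 'cV[R]_(2 + 2)) : R :=
  dual_wedge o0 o3 u1 u2 - dual_wedge o1 o2 u1 u2.

Definition omega (u1 u2 : 'cV[R]_(2 + 2)) : 'rV[R]_2 :=
  \row_(j < 2) if j == 0 then omega1 u1 u2 else omega2 u1 u2.

(* Points of Gr_2(R^4) are the U : {vspace 'cV[R]_(2 + 2)} with \dim U = 2;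
   points of RP^1 are the lines in 'rV[R]_2, [x : y] being <[(x, y)]>.
   omega (vbasis U)`_0 (vbasis U)`_1 depends on the basis only up to a nonzero
   factor: see in_calM_span and phi_span. *)
Definition in_calM (U : {vspace 'cV[R]_(2 + 2)}) : Prop :=
  \dim U = 2%N /\ omega (vbasis U)`_0 (vbasis U)`_1 != 0.

Definition phi (U : {vspace 'cV[R]_(2 + 2)}) : {vspace 'rV[R]_2} :=
  <[omega (vbasis U)`_0 (vbasis U)`_1]>%VS.

Definition tau_coord (z : 'rV[R]_2) : R[i] :=
  let c := (z 0 0 -i* z 0 1)%C in (c / `|c|) ^+ 2.

(* The value is the same at every nonzero vector of the line: see tau_line. *)
Definition tau (l : {vspace 'rV[R]_2}) : R[i] := tau_coord (vpick l).

(* Degree of a loop in the unit circle of R[i], parametrised by [0, 4], in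
   terms of a continuous choice of argument. *)
Definition has_degree (gamma : R -> R[i]) (n : int) : Prop :=
  exists theta : R -> R,
    [/\ {within `[0, 4], continuous theta},
        forall t, t \in `[0, 4] -> gamma t = (cos (theta t) +i* sin (theta t))%C
      & theta 4 - theta 0 = n%:~R * (2 * pi)].

(* The boundary of [x1, x2] x [l1, l2], counterclockwise from (x1, l1), one side
   on each of [0, 1], [1, 2], [2, 3], [3, 4]. *)
Definition rect_boundary (x1 x2 l1 l2 t : R) : R * R :=
  if t <= 1 then (x1 + t * (x2 - x1), l1)
  else if t <= 2 then (x2, l1 + (t - 1) * (l2 - l1))
  else if t <= 3 then (x2 - (t - 2) * (x2 - x1), l2)
  else (x1, l2 - (t - 3) * (l2 - l1)).

Definition W_boundary (A : 'M[R]_2) (d x1 x2 l1 l2 t : R) :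
    {vspace 'cV[R]_(2 + 2)} :=
  let p := rect_boundary x1 x2 l1 l2 t in W A d p.1 p.2.

(* "The index of [x1, x2] x [l1, l2] is defined and equal to n." *)
Definition has_index (A : 'M[R]_2) (d x1 x2 l1 l2 : R) (n : int) : Prop :=
  (forall t, t \in `[0, 4] -> in_calM (W_boundary A d x1 x2 l1 l2 t)) /\
  has_degree (tau \o phi \o W_boundary A d x1 x2 l1 l2) n.

Definition transversal_PD (A : 'M[R]_2) (d x lam : R) : Prop :=
  (W A d x lam :&: PD)%VS = 0%VS.

Definition admissible (A : 'M[R]_2) (d L lam_inf delta : R) : Prop :=
  [/\ 0 < lam_inf,
      forall x lam, 0 < x <= L -> lam_inf <= lam -> transversal_PD A d x lam,
      0 < delta < L
    & forall x lam, 0 < x <= delta -> 0 <= lam <= lam_inf ->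
        transversal_PD A d x lam].

Lemma linear_set_vspace (K : fieldType) (V : vectType K) (S : set V) :
    S 0 -> (forall a u v, S u -> S v -> S (a *: u + v)) ->
  exists U : {vspace V}, forall z, z \in U <-> S z.
Proof.
move=> S0 Slin.
pose P n := `[< exists U : {vspace V},
  (forall z, z \in U -> S z) /\ \dim U = n >].
have exP : exists n, P n.
  exists 0%N; apply/asboolP; exists 0%VS; split; last exact: dimv0.
  by move=> z; rewrite memv0 => /eqP ->.
have ubP n : P n -> (n <= \dim {:V})%N.
  by move=> /asboolP[U [_ <-]]; exact: dimvS (subvf U).
case: (ex_maxnP exP ubP) => n /asboolP[U [US dimU]] maxn.
exists U => z; split; first exact: US.
move=> Sz; apply: contrapT => /negP zU.
have : P (\dim (<[z]> + U)).
  apply/asboolP; exists (<[z]> + U)%VS; split => // y.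
  by move=> /memv_addP[_ /vlineP[k ->]] [v vU ->]; apply: Slin => //; exact: US.
move=> /maxn; rewrite -dimU => le_dim.
have /eqP eqU : U == (<[z]> + U)%VS by rewrite eqEdim addvSr.
by case/negP: zU; rewrite eqU (subvP (addvSl _ _)) ?memv_line.
Qed.

Lemma mem_W (A : 'M[R]_2) (d x lam : R) (z : 'cV[R]_(2 + 2)) :
  z \in W A d x lam <-> solution_values A d x lam z.
Proof.
rewrite /W; case: xgetP => [U _ -> //|/(_ _) /= noU].
have [||U UP] := @linear_set_vspace R _ (solution_values A d x lam);
  last by case: (noU U).
- exists (cst 0) => //; split; last by rewrite linear0.
  by move=> y; rewrite mulmx0; exact: is_derive_cst.
- move=> a _ _ [u [usol u0] <-] [v [vsol v0] <-].
  exists (a \*: u + v) => //; split; last first.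
    by rewrite /= linearP /= u0 v0 scaler0 addr0.
  move=> y; rewrite mulmxDr -scalemxAr.
  by apply: is_deriveD; [apply: is_deriveZ; exact: usol|exact: vsol].
Qed.

Lemma mem_PD (z : 'cV[R]_(2 + 2)) : z \in PD <-> exists p, z = col_mx 0 p.
Proof.
have lin : linear (fun p : 'cV[R]_2 => col_mx (0 : 'cV[R]_2) p).
  by move=> a u v; rewrite scale_col_mx add_col_mx scaler0 addr0.
pose f : {linear 'cV[R]_2 -> 'cV[R]_(2 + 2)} :=
  HB.pack (fun p : 'cV[R]_2 => col_mx (0 : 'cV[R]_2) p)
    (GRing.isLinear.Build R _ _ _ _ lin).
split => [/memv_imgP[p _ ->]|[p ->]]; first by exists p; rewrite (lfunE f).
by rewrite -[col_mx _ _](lfunE f) memv_img ?memvf.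
Qed.

Lemma omega_comb (b1 b2 u1 u2 : 'cV[R]_(2 + 2)) :
  u1 \in <<[:: b1; b2]>>%VS -> u2 \in <<[:: b1; b2]>>%VS ->
  exists k, omega u1 u2 = k *: omega b1 b2.
Proof.
rewrite span_cons span_seq1.
move=> /memv_addP[_ /vlineP[a ->]] [_ /vlineP[b ->] ->].
move=> /memv_addP[_ /vlineP[c ->]] [_ /vlineP[e ->] ->].
exists (a * e - b * c); apply/rowP => j; rewrite !mxE.
by case: ifP => _; rewrite /omega1 /omega2 /dual_wedge !mxE; ring.
Qed.

Lemma omega_basis (U : {vspace 'cV[R]_(2 + 2)}) (u1 u2 : 'cV[R]_(2 + 2)) :
  basis_of U [:: u1; u2] ->
  exists k l, omega u1 u2 = k *: omega (vbasis U)`_0 (vbasis U)`_1 /\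
              omega (vbasis U)`_0 (vbasis U)`_1 = l *: omega u1 u2.
Proof.
move=> Uu; have Ub := vbasisP U.
have dimU : \dim U = 2%N := size_basis (X := [tuple u1; u2]) Uu.
have eqb : vbasis U = [:: (vbasis U)`_0; (vbasis U)`_1] :> seq _.
  have : size (vbasis U) = 2%N by rewrite size_tuple dimU.
  by case: (tval _) => [|b0 [|b1 [|]]].
have spanb := span_basis Ub; rewrite eqb in spanb.
have spanu := span_basis Uu.
have [k ek] : exists k, omega u1 u2 = k *: omega (vbasis U)`_0 (vbasis U)`_1.
  by apply: omega_comb; rewrite spanb (basis_mem Uu) ?inE ?eqxx ?orbT.
have [l el] : exists l, omega (vbasis U)`_0 (vbasis U)`_1 = l *: omega u1 u2.
  by apply: omega_comb; rewrite spanu vbasis_mem // mem_nth // size_tuple dimU.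
by exists k, l.
Qed.

Lemma in_calM_span (U : {vspace 'cV[R]_(2 + 2)}) (u1 u2 : 'cV[R]_(2 + 2)) :
  basis_of U [:: u1; u2] -> in_calM U <-> omega u1 u2 != 0.
Proof.
move=> Uu; have [k [l [ek el]]] := omega_basis Uu.
split=> [[_]|nz]; first by apply: contraNneq => e; rewrite el e scaler0.
split; first exact: (size_basis (X := [tuple u1; u2]) Uu).
by apply: contraNneq nz => e; rewrite ek e scaler0.
Qed.

Lemma phi_span (U : {vspace 'cV[R]_(2 + 2)}) (u1 u2 : 'cV[R]_(2 + 2)) :
  basis_of U [:: u1; u2] -> phi U = <[omega u1 u2]>%VS.
Proof.
move=> Uu; have [k [l [ek el]]] := omega_basis Uu.
apply/eqP; rewrite /phi eqEsubv -!memvE; apply/andP; split.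
  by rewrite el memvZ ?memv_line.
by rewrite ek memvZ ?memv_line.
Qed.

Lemma tau_line (z : 'rV[R]_2) : z != 0 -> tau <[z]>%VS = tau_coord z.
Proof.
move=> z0; have /vlineP[k ek] := memv_pick <[z]>%VS.
have k0 : k != 0.
  apply: contraNneq z0 => k0; move: ek; rewrite k0 scale0r => /eqP.
  by rewrite vpick0 => /eqP e; rewrite -memv0 -e memv_line.
rewrite /tau ek /tau_coord !mxE.
have -> : (k * z 0 0 -i* (k * z 0 1) = k%:C * (z 0 0 -i* z 0 1))%C.
  by apply/eqP; rewrite eq_complex /=; apply/andP; split; apply/eqP; ring.
rewrite normrM invfM mulrACA exprMn.
suff -> : (k%:C%C / `|k%:C%C|) ^+ 2 = 1 :> R[i] by rewrite mul1r.
rewrite expr_div_n real_normK ?divff ?expf_neq0 //.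
  by rewrite eq_complex /= eqxx andbT.
by rewrite complex_real.
Qed.

End Defs.

(* Main.v *)
Require Import Defs.
From mathcomp Require Import all_boot all_order all_algebra.
From mathcomp Require Import complex.
From mathcomp Require Import all_classical all_reals all_analysis.
From mathcomp Require Import ring lra.
Import Order.TTheory GRing.Theory Num.Theory.
Import numFieldNormedType.Exports.
Local Open Scope classical_set_scope.
Local Open Scope ring_scope.

(* Write B = D^-1 (A - lam), T = tr B, q = sqrt (det B); det B > 0 for all
   lam >= 0.  On W(x, lam) the pair (omega_1, omega_2) is (f, f'), where
   f(x, lam) = (c(al, x/2)^2 - c(be, x/2)^2) / q with al = T - 2q, be = T + 2q,
   c(m, y) = cos (sqrt m * y) (a hyperbolic cosine for m < 0) and f' = df/dx.
   If al < 0 then f > 0 for x > 0; if al >= 0 then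
   f = sin (hi x) sin (lo x) / q where hi, lo = (sqrt be +- sqrt al) / 2.
   The inequality of the theorem says al > 0 at lam = 0, and al decreases in
   lam.  When it fails, f = 0 forces f' = 0, so on an admissible boundary f
   never vanishes and the loop, avoiding -1, has degree 0.  When it holds, take
   lam1 with al small and positive, and L = pi / lo(lam1).  On the bottom side
   (f, f') turns like the angle hi x; on the right side it is followed back by
   hi(lam) L up to shortly before lam1, where f < 0, and it crosses f = 0
   through f' > 0 at lam1, after which f > 0 up to the starting corner.
   This is one full turn of (f, f'), hence degree 2. *)

(** * Generalized sine and cosine *)

Section GeneralizedCosine.
Context {R : realType}.
Implicit Types m x y : R.

Definition cosh y : R := (expR y + expR (- y)) / 2.
Definition sinh y : R := (expR y - expR (- y)) / 2.

Lemma is_derive_expRN y : is_derive y 1 (fun z : R => expR (- z)) (- expR (- y)).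
Proof.
have -> : (fun z : R => expR (- z)) = expR \o -%R by [].
by apply: is_derive_eq; rewrite mulrN1.
Qed.

Lemma is_derive_cosh y : is_derive y 1 cosh (sinh y).
Proof.
have -> : cosh = 2^-1 \*: (expR + (fun z : R => expR (- z))).
  by apply/funext => z; rewrite /cosh mulrC.
have H := is_derive_expRN y.
by apply: is_derive_eq; rewrite /sinh mulrC.
Qed.

Lemma is_derive_sinh y : is_derive y 1 sinh (cosh y).
Proof.
have -> : sinh = 2^-1 \*: (expR - (fun z : R => expR (- z))).
  by apply/funext => z; rewrite /sinh mulrC.
have H := is_derive_expRN y.
by apply: is_derive_eq; rewrite /cosh mulrC opprK.
Qed.

Lemma cosh0 : cosh 0 = 1.
Proof. by rewrite /cosh oppr0 expR0; lra. Qed.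

Lemma sinh0 : sinh 0 = 0.
Proof. by rewrite /sinh oppr0 subrr mul0r. Qed.

Lemma cosh2Bsinh2 y : cosh y ^+ 2 - sinh y ^+ 2 = 1.
Proof. by rewrite /cosh /sinh expRN; field; exact: lt0r_neq0 (expR_gt0 y). Qed.

Lemma continuous_cosh : continuous cosh.
Proof.
move=> y; apply/differentiable_continuous/derivable1_diffP.
by have [] := is_derive_cosh y.
Qed.

Lemma continuous_sinh : continuous sinh.
Proof.
move=> y; apply/differentiable_continuous/derivable1_diffP.
by have [] := is_derive_sinh y.
Qed.

Lemma cosh_lt x y : 0 <= x -> x < y -> cosh x < cosh y.
Proof.
move=> x0 xy; rewrite -subr_gt0.
have -> : cosh y - cosh x = (expR y - expR x) * (1 - expR (- (x + y))) / 2.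
  rewrite /cosh !(opprD, expRD, expRN).
  by field; rewrite !lt0r_neq0 ?expR_gt0.
rewrite divr_gt0 // mulr_gt0 // subr_gt0 ?ltr_expR //.
by rewrite expR_lt1 oppr_lt0; lra.
Qed.

(* [Num.sqrt] vanishes on negative numbers, so one of the two factors is
   always 1. *)
Definition cosm m x : R := cos (Num.sqrt m * x) * cosh (Num.sqrt (- m) * x).

(** The solution of [y'' = - m y] with [y 0 = 0] and [y' 0 = 1]. The division by the frequency
    forces the case split, and [m = 0] takes the limit value [x]. *)
Definition sinm m x : R :=
  if m == 0 then x
  else if 0 < m then sin (Num.sqrt m * x) / Num.sqrt m
  else sinh (Num.sqrt (- m) * x) / Num.sqrt (- m).

Lemma cosm_ge0E m x : 0 <= m -> cosm m x = cos (Num.sqrt m * x).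
Proof.
by move=> m0; rewrite /cosm [Num.sqrt (- m)]ler0_sqrtr ?oppr_le0 // mul0r cosh0 mulr1.
Qed.

Lemma cosm_le0E m x : m <= 0 -> cosm m x = cosh (Num.sqrt (- m) * x).
Proof. by move=> m0; rewrite /cosm ler0_sqrtr // mul0r cos0 mul1r. Qed.

(** Multiplying by [m] removes both the division and the case split: one of the two terms is always
    0. This form is the one whose continuity in [m] is visible. *)
Lemma mul_sinmE m x : m * sinm m x =
  Num.sqrt m * sin (Num.sqrt m * x) - Num.sqrt (- m) * sinh (Num.sqrt (- m) * x).
Proof.
rewrite /sinm; case: (ltgtP m 0) => [m0|m0|->].
- rewrite [Num.sqrt m]ler0_sqrtr ?(ltW m0) // !mul0r sub0r.
  have s0 : 0 < Num.sqrt (- m) by rewrite sqrtr_gt0 oppr_gt0.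
  have ms : m = - Num.sqrt (- m) ^+ 2 by rewrite sqr_sqrtr ?opprK // oppr_ge0 ltW.
  rewrite [X in X * _]ms.
  by field; exact: lt0r_neq0.
- rewrite [Num.sqrt (- m)]ler0_sqrtr ?oppr_le0 ?(ltW m0) // !mul0r subr0.
  have s0 : 0 < Num.sqrt m by rewrite sqrtr_gt0.
  rewrite -[X in X * _](sqr_sqrtr (ltW m0)).
  by field; exact: lt0r_neq0.
- by rewrite oppr0 sqrtr0 !mul0r subrr.
Qed.

Lemma is_derive_scaled (f : R -> R) (k x df : R) :
  is_derive (k * x) 1 f df -> is_derive x 1 (fun z => f (k * z)) (k * df).
Proof.
move=> dF; have -> : (fun z => f (k * z)) = f \o (k \*: id) by [].
by apply: is_derive_eq; rewrite [_%:A]mulr1 mulrC.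
Qed.

Lemma is_derive_cosm m x : is_derive x 1 (cosm m) (- (m * sinm m x)).
Proof.
have [m0|/ltW m0] := leP 0 m.
- have -> : cosm m = fun z => cos (Num.sqrt m * z).
    by apply/funext => z; rewrite cosm_ge0E.
  apply: (is_derive_eq (is_derive_scaled _ _ _ _ (is_derive_cos _))).
  by rewrite mul_sinmE [Num.sqrt (- m)]ler0_sqrtr ?oppr_le0 // !mul0r subr0 mulrN.
- have -> : cosm m = fun z => cosh (Num.sqrt (- m) * z).
    by apply/funext => z; rewrite cosm_le0E.
  apply: (is_derive_eq (is_derive_scaled _ _ _ _ (is_derive_cosh _))).
  by rewrite mul_sinmE [Num.sqrt m]ler0_sqrtr // !mul0r sub0r opprK.
Qed.

Lemma is_derive_sinm m x : is_derive x 1 (sinm m) (cosm m x).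
Proof.
rewrite /sinm; case: (ltgtP m 0) => [m0|m0|->].
- have s0 : 0 < Num.sqrt (- m) by rewrite sqrtr_gt0 oppr_gt0.
  rewrite cosm_le0E ?ltW //.
  have -> : (fun z => sinh (Num.sqrt (- m) * z) / Num.sqrt (- m)) =
    (Num.sqrt (- m))^-1 \*: (fun z => sinh (Num.sqrt (- m) * z)).
    by apply/funext => z; rewrite mulrC.
  apply: (is_derive_eq (is_deriveZ _ (is_derive_scaled _ _ _ _ (is_derive_sinh _)))).
  by rewrite /GRing.scale /= mulrA mulVf ?mul1r // lt0r_neq0.
- have s0 : 0 < Num.sqrt m by rewrite sqrtr_gt0.
  rewrite cosm_ge0E ?ltW //.
  have -> : (fun z => sin (Num.sqrt m * z) / Num.sqrt m) =
    (Num.sqrt m)^-1 \*: (fun z => sin (Num.sqrt m * z)).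
    by apply/funext => z; rewrite mulrC.
  apply: (is_derive_eq (is_deriveZ _ (is_derive_scaled _ _ _ _ (is_derive_sin _)))).
  by rewrite /GRing.scale /= mulrA mulVf ?mul1r // lt0r_neq0.
- rewrite cosm_ge0E // sqrtr0 mul0r cos0; exact: is_derive_id.
Qed.

Lemma cosm0 m : cosm m 0 = 1.
Proof. by rewrite /cosm !mulr0 cos0 cosh0 mulr1. Qed.

Lemma sinm0 m : sinm m 0 = 0.
Proof.
by rewrite /sinm !mulr0 sin0 sinh0 !mul0r; case: ifP => // _; case: ifP.
Qed.

Lemma cosm2Dsinm2 m x : cosm m x ^+ 2 + m * sinm m x ^+ 2 = 1.
Proof.
have [->|mN0] := eqVneq m 0.
  by rewrite mul0r addr0 cosm_ge0E // sqrtr0 mul0r cos0 expr1n.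
(* The factor [m] is added because only [m * sinm m x] has a formula valid for both signs. *)
suff : m * (cosm m x ^+ 2 + m * sinm m x ^+ 2) = m * 1.
  by move=> /mulfI; exact.
rewrite mulrDr (_ : m * (m * sinm m x ^+ 2) = (m * sinm m x) ^+ 2); last by ring.
rewrite mul_sinmE.
have [m0|/ltW m0] := leP 0 m.
- rewrite cosm_ge0E // [Num.sqrt (- m)]ler0_sqrtr ?oppr_le0 // !mul0r subr0.
  by rewrite exprMn sqr_sqrtr // -mulrDr cos2Dsin2.
- rewrite cosm_le0E // [Num.sqrt m]ler0_sqrtr // !mul0r sub0r sqrrN.
  rewrite [(_ * sinh _) ^+ 2]exprMn sqr_sqrtr ?oppr_ge0 //.
  by rewrite mulNr -mulrBr cosh2Bsinh2.
Qed.

Lemma continuous_cosm_comp (T : topologicalType) (g h : T -> R) :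
  continuous g -> continuous h -> continuous (fun t => cosm (g t) (h t)).
Proof.
move=> cg ch t; rewrite /cosm; apply: cvgM.
- apply: (continuous_comp (f := fun t => Num.sqrt (g t) * h t) (g := cos));
    last exact: continuous_cos.
  apply: cvgM; last exact: ch.
  by apply: (continuous_comp (f := g)); [exact: cg|exact: sqrt_continuous].
- apply: (continuous_comp (f := fun t => Num.sqrt (- g t) * h t) (g := cosh));
    last exact: continuous_cosh.
  apply: cvgM; last exact: ch.
  apply: (continuous_comp (f := fun t => - g t)); last exact: sqrt_continuous.
  by apply: cvgN; exact: cg.
Qed.

(** The product with [m] is the only form in which [sinm] enters [frame_det']. *)
Lemma continuous_mul_sinm_comp (T : topologicalType) (g h : T -> R) :
  continuous g -> continuous h ->
  continuous (fun t => g t * sinm (g t) (h t)).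
Proof.
move=> cg ch.
have csg : continuous (fun t => Num.sqrt (g t)).
  move=> t; apply: (continuous_comp (f := g)); last exact: sqrt_continuous.
  exact: cg.
have csNg : continuous (fun t => Num.sqrt (- g t)).
  move=> t; apply: (continuous_comp (f := fun t => - g t)).
    by apply: cvgN; exact: cg.
  exact: sqrt_continuous.
rewrite (_ : (fun _ => _) = (fun t =>
  Num.sqrt (g t) * sin (Num.sqrt (g t) * h t)
  - Num.sqrt (- g t) * sinh (Num.sqrt (- g t) * h t))); last first.
  by apply/funext => t; rewrite mul_sinmE.
move=> t; apply: cvgB; apply: cvgM; [exact: csg| |exact: csNg|].
- apply: (continuous_comp (f := fun t => Num.sqrt (g t) * h t) (g := sin));
    last exact: continuous_sin.
  by apply: cvgM; [exact: csg|exact: ch].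
- apply: (continuous_comp (f := fun t => Num.sqrt (- g t) * h t) (g := sinh));
    last exact: continuous_sinh.
  by apply: cvgM; [exact: csNg|exact: ch].
Qed.

End GeneralizedCosine.

(** * Linear systems and the propagator *)

Section LinearSystem.
Context {R : realType}.

Lemma is_derive_mxP {m n : nat} (M : R -> 'M[R]_(m, n)) (x : R) dM :
  is_derive x 1 M dM <-> forall i j, is_derive x 1 (fun t => M t i j) (dM i j).
Proof.
split=> [[dM1 dM2] i j|H].
  have /derivable_mxP dij := dM1; split; first exact: dij.
  by move: dM2; rewrite derive_mx // => <-; rewrite mxE.
have dM1 : derivable M x 1 by apply/derivable_mxP => i j; case: (H i j).
split=> //; rewrite derive_mx //; apply/matrixP => i j; rewrite mxE.
by case: (H i j).
Qed.

Lemma derive_le0_nincr (f f' : R -> R) :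
  (forall x : R, is_derive x 1 f (f' x)) -> (forall x, f' x <= 0) ->
  forall x y, x <= y -> f y <= f x.
Proof.
move=> df f'le0 x y xy.
have cf : {within `[x, y], continuous f}.
  apply: continuous_subspaceT => z.
  by apply/differentiable_continuous/derivable1_diffP; case: (df z).
have [z _ fyx] := MVT_segment xy (fun z _ => df z) cf.
by rewrite -subr_le0 fyx mulr_le0_ge0 // subr_ge0.
Qed.

(** Gronwall in both directions: [V t * expR (- K * t)] is nonincreasing and [V t * expR (K * t)] is
    nondecreasing, so a zero of the nonnegative [V] spreads to the right and to the left. *)
Lemma gronwall_zero (V V' : R -> R) (K : R) :
  (forall x : R, is_derive x 1 V (V' x)) -> (forall x, 0 <= V x) ->
  (forall x, `|V' x| <= K * V x) ->
  forall x y, V x = 0 -> V y = 0.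
Proof.
move=> dV V0 V'le x y Vx0; apply/eqP; rewrite eq_le V0 andbT.
have dexp (k z : R) : is_derive z 1 (fun t => expR (k * t)) (k * expR (k * z)).
  have -> : (fun t => expR (k * t)) = expR \o (k \*: id) by [].
  by apply: is_derive_eq; rewrite [_%:A]mulr1 mulrC.
have dprod (k z : R) : is_derive z 1 (fun t => V t * expR (k * t))
    ((V' z + k * V z) * expR (k * z)).
  apply: (is_derive_eq (is_deriveM (dV z) (dexp k z))).
  by rewrite /GRing.scale /=; ring.
have bnd z : - (K * V z) <= V' z <= K * V z by rewrite -ler_norml.
have [xy|/ltW yx] := leP x y.
- have : V y * expR (- K * y) <= V x * expR (- K * x).
    apply: (derive_le0_nincr _ _ (dprod (- K))) => // z.
    apply: mulr_le0_ge0; last exact: expR_ge0.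
    by have /andP[_] := bnd z; rewrite mulNr subr_le0.
  by rewrite Vx0 mul0r pmulr_lle0 // expR_gt0.
- have : - (V x * expR (K * x)) <= - (V y * expR (K * y)).
    apply: (derive_le0_nincr (- (fun t => V t * expR (K * t)))
      (fun z => - ((V' z + K * V z) * expR (K * z)))) => // z.
    rewrite oppr_le0 mulr_ge0 ?expR_ge0 //.
    by have /andP[+ _] := bnd z; rewrite -subr_ge0 opprK.
  by rewrite Vx0 mul0r oppr0 oppr_ge0 pmulr_lle0 // expR_gt0.
Qed.

(** Gronwall applied to the squared Euclidean norm [V] of [u], whose derivative is a quadratic form
    in [u] and hence bounded by a multiple of [V]. *)
Lemma linear_ode_zero {n : nat} (M : 'M[R]_n) (u : R -> 'cV[R]_n) :
  (forall x : R, is_derive x 1 u (M *m u x)) ->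
  forall x y, u x = 0 -> u y = 0.
Proof.
move=> du x y ux0.
pose V z := \sum_i (u z i 0) ^+ 2.
pose V' z := \sum_i 2 * u z i 0 * (M *m u z) i 0.
have V0 z : 0 <= V z by apply: sumr_ge0 => i _; exact: sqr_ge0.
have leV z i : (u z i 0) ^+ 2 <= V z.
  by rewrite /V (bigD1 i) //= lerDl; apply: sumr_ge0 => j _; exact: sqr_ge0.
have dV (z : R) : is_derive z 1 V (V' z).
  have -> : V = \sum_i (fun t => (u t i 0) ^+ 2).
    by apply/funext => t; rewrite fct_sumE.
  apply: is_derive_sum => i.
  have /is_derive_mxP/(_ i 0) dui := du z.
  rewrite (_ : (fun t => _) = (fun t => u t i 0) * (fun t => u t i 0)); last first.
    by apply/funext => t; rewrite expr2.
  apply: (is_derive_eq (is_deriveM dui dui)).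
  by rewrite /GRing.scale /=; ring.
pose K := \sum_i \sum_j 2 * `|M i j|.
have V'le z : `|V' z| <= K * V z.
  apply: (le_trans (ler_norm_sum _ _ _)); rewrite /K mulr_suml.
  apply: ler_sum => i _; rewrite mxE mulr_sumr mulr_suml.
  apply: (le_trans (ler_norm_sum _ _ _)); apply: ler_sum => j _.
  rewrite !normrM (ger0_norm (_ : 0 <= 2)) //.
  rewrite [leLHS](_ : _ = 2 * `|M i j| * (`|u z i 0| * `|u z j 0|)); last by ring.
  rewrite ler_wpM2l ?mulr_ge0 //.
  (* A product [|a| |b|] is at most the mean of the two squares, each of which is at most [V z]. *)
  have := leV z i; have := leV z j.
  rewrite -[u z i 0 ^+ 2]real_normK ?num_real // -[u z j 0 ^+ 2]real_normK ?num_real //.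
  by have := sqr_ge0 (`|u z i 0| - `|u z j 0|); nra.
have : V y = 0.
  apply: (gronwall_zero V V' K dV V0 V'le x y); rewrite /V ux0.
  by apply: big1 => i _; rewrite mxE expr0n.
move=> Vy; apply/matrixP => i j; rewrite (ord1 j) mxE; apply/eqP.
by rewrite -sqrf_eq0 eq_le sqr_ge0 andbT -Vy leV.
Qed.

End LinearSystem.

Section SecondOrderSystem.
Context {R : realType}.
Variables (N : 'M[R]_2) (T q : R).
Hypotheses (trN : \tr N = - T) (detN : \det N = q ^+ 2) (q0 : q != 0).

Local Notation al := (T - 2 * q).
Local Notation be := (T + 2 * q).
Local Notation Ca x := (cosm al (x / 2)).
Local Notation Cb x := (cosm be (x / 2)).
Local Notation Sa x := (sinm al (x / 2)).
Local Notation Sb x := (sinm be (x / 2)).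

(* By Cayley-Hamilton the exponential of [x * sys], where
   [sys = block_mx 0 1 N 0] and [N ^ 2 = - T N - q ^ 2], is
   [c0 + c1 sys + c2 sys ^ 2 + c3 sys ^ 3]. *)
Definition c3 (x : R) := (Sb x * Ca x - Cb x * Sa x) / q.
Definition c2 (x : R) := 2 * (Sa x * Sb x).
Definition c1 (x : R) := Ca x * Sb x + Sa x * Cb x + T * c3 x.
Definition c0 (x : R) := Ca x * Cb x + T * (Sa x * Sb x).

Lemma is_derive_half (f : R -> R) (x df : R) :
  is_derive (x / 2) 1 f df -> is_derive x 1 (fun z => f (z / 2)) (df / 2).
Proof.
move=> dF; have -> : (fun z => f (z / 2)) = fun z => f (2^-1 * z).
  by apply/funext => z; rewrite mulrC.
rewrite (mulrC df); apply: is_derive_scaled.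
by rewrite mulrC.
Qed.

Let dCa x := is_derive_half _ _ _ (is_derive_cosm al (x / 2)).
Let dCb x := is_derive_half _ _ _ (is_derive_cosm be (x / 2)).
Let dSa x := is_derive_half _ _ _ (is_derive_sinm al (x / 2)).
Let dSb x := is_derive_half _ _ _ (is_derive_sinm be (x / 2)).

(** The four derivatives are the coefficients of [sys] times the exponential, once [sys ^ 4] is
    replaced by [- T sys ^ 2 - q ^ 2]. *)
Lemma is_derive_c3 (x : R) : is_derive x 1 c3 (c2 x).
Proof.
have -> : c3 = q^-1 \*: ((fun x => Sb x) * (fun x => Ca x)
                         - (fun x => Cb x) * (fun x => Sa x)).
  by apply/funext => z; rewrite /c3 mulrC.
apply: (is_derive_eq (is_deriveZ _ (is_deriveB
  (is_deriveM (dSb x) (dCa x)) (is_deriveM (dCb x) (dSa x))))).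
rewrite /GRing.scale /= /c2.
by move: q0 (Ca x) (Cb x) (Sa x) (Sb x) => *; field.
Qed.

Lemma is_derive_c2 (x : R) : is_derive x 1 c2 (c1 x - T * c3 x).
Proof.
have -> : c2 = 2 \*: ((fun x => Sa x) * (fun x => Sb x)) by [].
apply: (is_derive_eq (is_deriveZ _ (is_deriveM (dSa x) (dSb x)))).
by rewrite /GRing.scale /= /c1; field.
Qed.

Lemma is_derive_c1 (x : R) : is_derive x 1 c1 (c0 x).
Proof.
have -> : c1 = (fun x => Ca x) * (fun x => Sb x) + (fun x => Sa x) * (fun x => Cb x)
               + (T \*: c3) by [].
apply: (is_derive_eq (is_deriveD (is_deriveD (is_deriveM (dCa x) (dSb x))
  (is_deriveM (dSa x) (dCb x))) (is_deriveZ T (is_derive_c3 x)))).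
by rewrite /GRing.scale /= /c0 /c2; field.
Qed.

Lemma is_derive_c0 (x : R) : is_derive x 1 c0 (- q ^+ 2 * c3 x).
Proof.
have -> : c0 = (fun x => Ca x) * (fun x => Cb x)
               + (T \*: ((fun x => Sa x) * (fun x => Sb x))) by [].
apply: (is_derive_eq (is_deriveD (is_deriveM (dCa x) (dCb x))
  (is_deriveZ T (is_deriveM (dSa x) (dSb x))))).
rewrite /GRing.scale /= /c3.
by move: q0 (Ca x) (Cb x) (Sa x) (Sb x) => *; field.
Qed.

Lemma tr_mx2 (B : 'M[R]_2) : \tr B = B 0 0 + B 1 1.
Proof. by rewrite /mxtrace !big_ord_recl big_ord0 addr0; congr (_ + B _ _); apply/val_inj. Qed.

Lemma det_mx2 (B : 'M[R]_2) : \det B = B 0 0 * B 1 1 - B 0 1 * B 1 0.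
Proof.
rewrite (expand_det_row _ 0) !big_ord_recl big_ord0 addr0 /cofactor !det_mx11 !mxE /=.
rewrite !expr0 !mul1r expr1 mulN1r mulrN.
by congr (B _ _ * B _ _ - B _ _ * B _ _); apply/val_inj.
Qed.

Lemma mx2_cayley (i j : 'I_2) : (N *m N) i j = - T * N i j - q ^+ 2 * (i == j)%:R.
Proof.
rewrite -trN -detN tr_mx2 det_mx2 mxE !big_ord_recl big_ord0 addr0.
have e1 : lift ord0 ord0 = 1 :> 'I_2 by apply/val_inj.
rewrite e1; case: (unliftP ord0 i) => [i'|] ->; case: (unliftP ord0 j) => [j'|] ->;
  rewrite ?ord1 ?e1 /=; ring.
Qed.

(** The exponential applied to [(0, p)]: the successive images of [(0, p)] under [sys] are [(p, 0)],
    [(0, N p)] and [(N p, 0)]. *)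
Definition propagator (p : 'cV[R]_2) (x : R) : 'cV[R]_(2 + 2) :=
  col_mx (c1 x *: p + c3 x *: (N *m p)) (c0 x *: p + c2 x *: (N *m p)).

Let sys : 'M[R]_(2 + 2) := block_mx 0 1%:M N 0.

Lemma propagator_sol p (x : R) :
  is_derive x 1 (propagator p) (sys *m propagator p x).
Proof.
have lin (f g : R -> R) (f' g' a b : R) : is_derive x 1 f f' ->
    is_derive x 1 g g' ->
    is_derive x 1 (fun t => f t * a + g t * b) (f' * a + g' * b).
  move=> df dg.
  have -> : (fun t => f t * a + g t * b) = a \*: f + (b \*: g).
    by apply/funext => t; rewrite /= mulrC (mulrC (g t)).
  apply: (is_derive_eq (is_deriveD (is_deriveZ _ df) (is_deriveZ _ dg))).
  by rewrite /GRing.scale /=; ring.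
rewrite /sys /propagator mul_block_col !mul0mx mul1mx add0r addr0.
rewrite mulmxDr -!scalemxAr mulmxA.
(* Cayley-Hamilton brings the second derivative back to combinations of [p] and [N p], to be matched
   with the derivatives of the coefficients. *)
have -> : N *m N = - T *: N - q ^+ 2 *: 1%:M.
  by apply/matrixP => i j; rewrite mx2_cayley !mxE.
rewrite mulmxBl -!scalemxAl mul1mx.
apply/is_derive_mxP => i j; rewrite (ord1 j).
case: (splitP i) => k ik.
- have -> : i = lshift 2 k by apply/val_inj.
  rewrite col_mxEu.
  rewrite (_ : (fun t => _) = (fun t => c1 t * p k 0 + c3 t * (N *m p) k 0)); last first.
    by apply/funext => t; rewrite col_mxEu !mxE.
  apply: (is_derive_eq (lin _ _ _ _ _ _ (is_derive_c1 x) (is_derive_c3 x))).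
  by rewrite !mxE.
- have -> : i = rshift 2 k by apply/val_inj.
  rewrite col_mxEd.
  rewrite (_ : (fun t => _) = (fun t => c0 t * p k 0 + c2 t * (N *m p) k 0)); last first.
    by apply/funext => t; rewrite col_mxEd !mxE.
  apply: (is_derive_eq (lin _ _ _ _ _ _ (is_derive_c0 x) (is_derive_c2 x))).
  by rewrite !mxE; ring.
Qed.

Lemma propagator0 p : propagator p 0 = col_mx 0 p.
Proof.
rewrite /propagator /c1 /c0 /c2 /c3 !mul0r !sinm0 !cosm0.
by rewrite !(mulr0, mul0r, addr0, subr0, mulr1, scale0r, scale1r).
Qed.

Lemma propagator_unique (u : R -> 'cV[R]_(2 + 2)) :
  (forall x : R, is_derive x 1 u (sys *m u x)) -> usubmx (u 0) = 0 ->
  u = propagator (dsubmx (u 0)).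
Proof.
move=> du u0; apply/funext => x; apply/eqP; rewrite -subr_eq0; apply/eqP.
apply: (linear_ode_zero sys (u - propagator (dsubmx (u 0))) _ 0).
  by move=> z; rewrite mulmxBr; exact: (is_deriveB (du z) (propagator_sol _ z)).
change (u 0 - propagator (dsubmx (u 0)) 0 = 0).
by rewrite propagator0 -{1}(vsubmxK (u 0)) u0 subrr.
Qed.

Lemma propagator_inj x p : propagator p x = 0 -> p = 0.
Proof.
move=> px0; have := linear_ode_zero sys _ (propagator_sol p) x 0 px0.
by rewrite propagator0 => /(congr1 dsubmx); rewrite col_mxKd linear0.
Qed.

(* [frame_det] and [frame_det'] are the values of [omega1] and [omega2] on the
   frame of [W], the latter being the derivative in [x] of the former. *)
Definition frame_det (x : R) := (Ca x ^+ 2 - Cb x ^+ 2) / q.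
Definition frame_det' (x : R) := (be * Sb x * Cb x - al * Sa x * Ca x) / q.

(** A pair of equations, so that a single [rewrite] treats the upper and the lower entries. *)
Lemma propagator_delta (j : 'I_2) x i :
  (propagator (delta_mx j 0) x (lshift 2 i) 0 = c1 x * (i == j)%:R + c3 x * N i j)
  * (propagator (delta_mx j 0) x (rshift 2 i) 0 = c0 x * (i == j)%:R + c2 x * N i j).
Proof.
have e : (N *m (delta_mx j 0 : 'cV_2)) i 0 = N i j by rewrite -colE mxE.
rewrite mxE in e.
by split; rewrite /propagator ?col_mxEu ?col_mxEd !mxE e andbT.
Qed.

Lemma omega_propagator x :
  omega (propagator (delta_mx 0 0) x) (propagator (delta_mx 1 0) x)
  = \row_(j < 2) if j == 0 then frame_det x else frame_det' x.
Proof.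
have i0 : Ordinal (isT : (0 < 4)%N) = lshift 2 0 :> 'I_(2 + 2) by apply/val_inj.
have i1 : Ordinal (isT : (1 < 4)%N) = lshift 2 1 :> 'I_(2 + 2) by apply/val_inj.
have i2 : Ordinal (isT : (2 < 4)%N) = rshift 2 0 :> 'I_(2 + 2) by apply/val_inj.
have i3 : Ordinal (isT : (3 < 4)%N) = rshift 2 1 :> 'I_(2 + 2) by apply/val_inj.
have eT := trN; rewrite tr_mx2 in eT.
have eD := detN; rewrite det_mx2 in eD.
have ea := cosm2Dsinm2 al (x / 2); have eb := cosm2Dsinm2 be (x / 2).
apply/rowP => j; rewrite !mxE; case: ifP => _.
- rewrite /omega1 /dual_wedge i0 i1 !propagator_delta /= !(mulr0, mulr1, add0r).
  (* [omega1] is the determinant of [c1 + c3 N], expanded by the trace and determinant of [N]. *)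
  transitivity (c1 x ^+ 2 - T * (c1 x * c3 x) + q ^+ 2 * c3 x ^+ 2).
    by rewrite -eD -[T]opprK -eT; ring.
  transitivity ((be * Sb x ^+ 2 * Ca x ^+ 2 - al * Sa x ^+ 2 * Cb x ^+ 2) / q).
    by rewrite /c1 /c3; move: q0 (Ca x) (Cb x) (Sa x) (Sb x) => *; field.
  (* Replacing [m * sinm ^ 2] by [1 - cosm ^ 2] leaves the difference of the two squared cosines. *)
  move: ea eb => /(canRL (addKr _)) ea /(canRL (addKr _)) eb.
  by rewrite ea eb /frame_det; ring.
- rewrite /omega2 /dual_wedge i0 i1 i2 i3 !propagator_delta /= !(mulr0, mulr1, add0r).
  (* [omega2] polarizes that determinant: it is its derivative at [c1 + c3 N] in the direction
     [c0 + c2 N]. *)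
  transitivity (2 * c0 x * c1 x - T * (c0 x * c3 x + c1 x * c2 x)
                + 2 * q ^+ 2 * c2 x * c3 x).
    by rewrite -eD -[T]opprK -eT; ring.
  transitivity ((be * Sb x * Cb x * (Ca x ^+ 2 + al * Sa x ^+ 2)
    - al * Sa x * Ca x * (Cb x ^+ 2 + be * Sb x ^+ 2)) / q).
    by rewrite /c0 /c1 /c2 /c3; move: q0 (Ca x) (Cb x) (Sa x) (Sb x) => *; field.
  by rewrite ea eb !mulr1.
Qed.

End SecondOrderSystem.

(** * The plane W *)

Section PropagatorSpan.
Context {R : realType}.

Lemma propagator_comb (N : 'M[R]_2) (T q : R) p x :
  propagator N T q p x = p 0 0 *: propagator N T q (delta_mx 0 0) x
                         + p 1 0 *: propagator N T q (delta_mx 1 0) x.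
Proof.
have ep : p = p 0 0 *: delta_mx 0 0 + p 1 0 *: delta_mx 1 0.
  rewrite {1}(matrix_sum_delta p) !big_ord_recl !big_ord0 !addr0.
  by congr (_ *: delta_mx _ _ + p _ _ *: delta_mx _ _); apply/val_inj.
rewrite {1}ep /propagator !scale_col_mx add_col_mx !mulmxDr -!scalemxAr.
congr col_mx; rewrite !scalerDr !scalerA ![_ * p _ _]mulrC addrACA //.
Qed.

(* [reaction A d lam] is [- B] for [B = D^-1 (A - lam)], whose trace and
   determinant are [trB] and [detB]. *)
Definition reaction (A : 'M[R]_2) (d lam : R) : 'M[R]_2 :=
  invmx (diffusion d) *m (lam%:M - A).

Definition trB (A : 'M[R]_2) (d lam : R) : R :=
  (A 0 0 - lam) + (A 1 1 - lam) / d.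

Definition detB (A : 'M[R]_2) (d lam : R) : R :=
  (lam ^+ 2 - lam * \tr A + \det A) / d.

Definition sqrtdetB (A : 'M[R]_2) (d lam : R) : R := Num.sqrt (detB A d lam).

Section Reaction.
Variables (A : 'M[R]_2) (d : R).
Hypotheses (hdet : 0 < \det A) (htr : \tr A < 0) (hd : 0 < d).

Lemma reactionE lam (i j : 'I_2) : reaction A d lam i j =
  (if i == 0 then 1 else d^-1) * (lam * (i == j)%:R - A i j).
Proof.
pose E := diag_mx (\row_(k < 2) if k == 0 then 1 else d^-1).
have DE : diffusion d *m E = 1%:M.
  rewrite /diffusion /E mulmx_diag -diag_const_mx; congr diag_mx.
  apply/rowP => k; rewrite !mxE; case: ifP => _; first by rewrite mulr1.
  by rewrite divff // lt0r_neq0.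
have [Du _] := mulmx1_unit DE.
have -> : reaction A d lam = E *m (lam%:M - A).
  by rewrite /reaction -[invmx _]mulmx1 -DE mulmxA mulVmx // mul1mx.
by rewrite /E mul_diag_mx !mxE mulr_natr.
Qed.

Lemma tr_reaction lam : \tr (reaction A d lam) = - trB A d lam.
Proof. by rewrite tr_mx2 !reactionE /trB /=; ring. Qed.

Lemma detB_gt0 lam : 0 <= lam -> 0 < detB A d lam.
Proof.
move=> lam0; rewrite /detB divr_gt0 // ltr_wpDl //.
by rewrite -mulrN addr_ge0 ?sqr_ge0 // mulr_ge0 // ltW // oppr_gt0.
Qed.

Lemma sqrtdetB_gt0 lam : 0 <= lam -> 0 < sqrtdetB A d lam.
Proof. by move=> lam0; rewrite sqrtr_gt0 detB_gt0. Qed.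

Lemma sqr_sqrtdetB lam : 0 <= lam -> sqrtdetB A d lam ^+ 2 = detB A d lam.
Proof. by move=> lam0; rewrite sqr_sqrtr // ltW // detB_gt0. Qed.

Lemma det_reaction lam : 0 <= lam ->
  \det (reaction A d lam) = sqrtdetB A d lam ^+ 2.
Proof.
move=> lam0; rewrite sqr_sqrtdetB // det_mx2 !reactionE /detB det_mx2 tr_mx2 /=.
by move: (A _ _) (A _ _) (A _ _) (A _ _) => *; field; exact: lt0r_neq0.
Qed.

Variables (x lam : R).
Hypothesis lam0 : 0 <= lam.

Local Notation N := (reaction A d lam).
Local Notation T := (trB A d lam).
Local Notation q := (sqrtdetB A d lam).
Local Notation u0 := (propagator N T q (delta_mx 0 0) x).
Local Notation u1 := (propagator N T q (delta_mx 1 0) x).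

Let trN := tr_reaction lam.
Let detN := det_reaction lam lam0.
Let q0 : q != 0. Proof. by rewrite lt0r_neq0 // sqrtdetB_gt0. Qed.

Lemma mem_W_propagator z :
  z \in W A d x lam <-> exists p, z = propagator N T q p x.
Proof.
split=> [/mem_W[u [usol us0] <-]|[p ->]].
  exists (dsubmx (u 0)).
  by rewrite {1}(propagator_unique N T q trN detN q0 u usol us0).
apply/mem_W; exists (propagator N T q p) => //; split.
  by move=> y; exact: propagator_sol.
by rewrite propagator0 col_mxKu.
Qed.

Lemma W_span : W A d x lam = <<[:: u0; u1]>>%VS.
Proof.
apply/vspaceP => z; apply/idP/idP => [/mem_W_propagator[p ->]|].
  rewrite propagator_comb memvD // memvZ // memv_span // !inE eqxx ?orbT //.
rewrite span_cons span_seq1 => /memv_addP[_ /vlineP[a ->]] [_ /vlineP[b ->] ->].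
apply/mem_W_propagator.
exists (a *: delta_mx 0 0 + b *: delta_mx 1 0).
rewrite [RHS]propagator_comb !mxE /=.
by rewrite !(mulr1, mulr0, addr0, add0r).
Qed.

Let frame : omega u0 u1 = \row_(j < 2)
  if j == 0 then frame_det T q x else frame_det' T q x :=
  omega_propagator N T q trN detN q0 x.

(** Both forms are alternating, so a nonzero value on the two generators makes them independent. *)
Lemma basis_W : omega u0 u1 != 0 -> basis_of (W A d x lam) [:: u0; u1].
Proof.
move=> nz; rewrite /basis_of W_span eqxx /=.
have om0l (v : 'cV[R]_(2 + 2)) : omega 0 v = 0.
  apply/rowP => j; rewrite !mxE /omega1 /omega2 /dual_wedge !mxE.
  by case: ifP => _; ring.
have omll (k : R) (v : 'cV[R]_(2 + 2)) : omega (k *: v) v = 0.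
  apply/rowP => j; rewrite !mxE /omega1 /omega2 /dual_wedge !mxE.
  by case: ifP => _; ring.
have omr0 (v : 'cV[R]_(2 + 2)) : omega v 0 = 0.
  apply/rowP => j; rewrite !mxE /omega1 /omega2 /dual_wedge !mxE.
  by case: ifP => _; ring.
rewrite !free_cons span_seq1 span_nil nil_free memv0 andbT.
apply/andP; split; last by apply: contraNneq nz => ->; rewrite omr0.
by apply: contra nz => /vlineP[k ->]; rewrite omll.
Qed.

Lemma in_calM_W : in_calM (W A d x lam) <->
  (frame_det T q x != 0) || (frame_det' T q x != 0).
Proof.
have omE : (omega u0 u1 != 0) = (frame_det T q x != 0) || (frame_det' T q x != 0).
  rewrite -negb_and frame; congr negb; apply/eqP/andP => [/rowP e|[/eqP e /eqP e']].
    by have := e 0; have := e 1; rewrite !mxE /= => -> ->.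
  by apply/rowP => j; rewrite !mxE; case: ifP.
rewrite -omE; split=> [[dimW nz]|nz]; last first.
  by apply/(in_calM_span (basis_W nz)).
(* Two generators of a space of dimension 2 form a basis, so [omega] may be evaluated on them. *)
suff /in_calM_span <- : basis_of (W A d x lam) [:: u0; u1] by split.
by rewrite basisEdim W_span subvv -W_span dimW.
Qed.

Lemma tau_phi_W : in_calM (W A d x lam) ->
  tau (phi (W A d x lam)) =
    ((frame_det T q x -i* frame_det' T q x)
     / `|frame_det T q x -i* frame_det' T q x|)%C ^+ 2.
Proof.
move=> [dimW nz].
have bW : basis_of (W A d x lam) [:: u0; u1].
  by rewrite basisEdim W_span subvv -W_span dimW.
have nz' := (in_calM_span bW).1 (conj dimW nz).
by rewrite (phi_span bW) tau_line // frame /tau_coord !mxE.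
Qed.

(** [frame_det] is the determinant of the map from the initial slope [p] to [v(x)], and the kernel
    of this map corresponds to the intersection with [PD]. *)
Lemma transversal_PD_W : transversal_PD A d x lam <-> frame_det T q x != 0.
Proof.
pose S : 'M[R]_2 := \matrix_(i, j) propagator N T q (delta_mx j 0) x (lshift 2 i) 0.
have topS p i : propagator N T q p x (lshift 2 i) 0 = (S *m p) i 0.
  rewrite propagator_comb !mxE !big_ord_recl big_ord0 addr0 !mxE.
  have -> : lift ord0 ord0 = 1 :> 'I_2 by apply/val_inj.
  by rewrite (mulrC (p 0 0)) (mulrC (p 1 0)).
have detS : \det S = frame_det T q x.
  have /rowP/(_ 0) := frame; rewrite !mxE /= /omega1 /dual_wedge => <-.
  have -> : Ordinal (isT : (0 < 4)%N) = lshift 2 0 :> 'I_(2 + 2) by apply/val_inj.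
  have -> : Ordinal (isT : (1 < 4)%N) = lshift 2 1 :> 'I_(2 + 2) by apply/val_inj.
  by rewrite det_mx2 !mxE; ring.
rewrite -detS; split=> [trans|Snz].
  apply/negP; rewrite -det_tr => /det0P[v v0 vS].
  have Sp : S *m v^T = 0 by rewrite -[S]trmxK -trmx_mul vS trmx0.
  suff p0 : v^T = 0 by move: v0; rewrite -[v]trmxK p0 trmx0 eqxx.
  (* A kernel vector gives a solution value lying in [PD], hence 0; uniqueness for the system then
     makes [p] itself 0. *)
  apply: (propagator_inj N T q trN detN q0 x).
  apply/eqP; rewrite -memv0 -trans memv_cap; apply/andP; split.
    by apply/mem_W_propagator; exists v^T.
  apply/mem_PD; exists (dsubmx (propagator N T q v^T x)).
  rewrite -{1}(vsubmxK (propagator N T q v^T x)); congr col_mx.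
  by apply/matrixP => i j; rewrite (ord1 j) mxE topS Sp.
apply/eqP; rewrite -subv0; apply/subvP => z.
rewrite memv_cap => /andP[/mem_W_propagator[p ->] /mem_PD[r er]].
suff -> : p = 0.
  by rewrite propagator_comb !mxE !scale0r addr0 mem0v.
have Sp : S *m p = 0.
  by apply/matrixP => i j; rewrite (ord1 j) -topS er col_mxEu !mxE.
have Su : S \in unitmx by rewrite unitmxE unitfE.
by rewrite -[p](mulKmx Su) Sp mulmx0.
Qed.

End Reaction.
End PropagatorSpan.

(** * Signs of the frame determinant *)

Section FrameDetSign.
Context {R : realType}.
Variables (T q : R).
Implicit Types x : R.
Hypothesis q0 : 0 < q.

Local Notation al := (T - 2 * q).
Local Notation be := (T + 2 * q).

Lemma cosh_ge1 (y : R) : 1 <= cosh y.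
Proof.
have := expR_gt0 y; have e : expR y * expR (- y) = 1 by rewrite expRN divff // lt0r_neq0 // expR_gt0.
have := expR_gt0 (- y); rewrite /cosh.
by have := sqr_ge0 (expR y - expR (- y)); nra.
Qed.

(** The [al] term is a hyperbolic cosine, larger than 1. The [be] term is either a cosine or, as
    [- be < - al], a smaller hyperbolic cosine. *)
Lemma frame_det_gt0 x : al < 0 -> 0 < x -> 0 < frame_det T q x.
Proof.
move=> al0 x0; rewrite /frame_det divr_gt0 // subr_gt0.
have x20 : 0 < x / 2 by rewrite divr_gt0.
have sal : 0 < Num.sqrt (- al) by rewrite sqrtr_gt0 oppr_gt0.
rewrite (cosm_le0E al) ?(ltW al0) //.
have [be0|be0] := leP 0 be.
  rewrite cosm_ge0E // cos2sin2 (@le_lt_trans _ _ 1) ?gerBl ?sqr_ge0 //.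
  by rewrite exprn_egt1 // -[X in X < _]cosh0 cosh_lt // mulr_gt0.
rewrite cosm_le0E ?(ltW be0) // ltr_pXn2r ?nnegrE ?(le_trans ler01 (cosh_ge1 _)) //.
rewrite cosh_lt ?mulr_ge0 ?sqrtr_ge0 ?ltW //.
by rewrite ltr_pM2r // ltr_sqrt ?oppr_gt0 //; move: q0; lra.
Qed.

(** For [0 <= T - 2 * q] these are the spatial frequencies: their squares have sum [T] and product
    [q ^ 2], hence are the eigenvalues of [B]. *)
Definition freq_hi : R := (Num.sqrt be + Num.sqrt al) / 2.
Definition freq_lo : R := (Num.sqrt be - Num.sqrt al) / 2.

Section RealFrequencies.
Hypothesis al0 : 0 <= al.

Let be0 : 0 < be. Proof. by move: q0 al0; lra. Qed.
Let sbe : Num.sqrt be ^+ 2 = be. Proof. by rewrite sqr_sqrtr // ltW. Qed.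
Let sal : Num.sqrt al ^+ 2 = al. Proof. by rewrite sqr_sqrtr. Qed.

Lemma freq_lo_gt0 : 0 < freq_lo.
Proof. by rewrite divr_gt0 // subr_gt0 ltr_sqrt //; move: q0; lra. Qed.

Lemma freq_lo_hi : freq_lo <= freq_hi.
Proof. by rewrite /freq_lo /freq_hi; have := sqrtr_ge0 al; lra. Qed.

Lemma freq_lo_hi_lt : 0 < al -> freq_lo < freq_hi.
Proof. by rewrite -sqrtr_gt0 /freq_lo /freq_hi; lra. Qed.

Lemma freq_hi_gt0 : 0 < freq_hi.
Proof. exact: lt_le_trans freq_lo_gt0 freq_lo_hi. Qed.

Lemma freq_mul : freq_hi * freq_lo = q.
Proof.
rewrite (_ : _ * _ = (Num.sqrt be ^+ 2 - Num.sqrt al ^+ 2) / 4); last first.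
  by rewrite /freq_hi /freq_lo; field.
by rewrite sbe sal; field.
Qed.

Lemma freq_sqrD : freq_hi ^+ 2 + freq_lo ^+ 2 = T.
Proof.
rewrite (_ : _ + _ = (Num.sqrt be ^+ 2 + Num.sqrt al ^+ 2) / 2); last first.
  by rewrite /freq_hi /freq_lo; field.
by rewrite sbe sal; field.
Qed.

(** The conclusion amounts to [be > 9 * al], and [be = al + 4 * q]. *)
Lemma freq_hi_lt2 : 2 * al < q -> freq_hi < 2 * freq_lo.
Proof.
move=> alq; suff : Num.sqrt be > 3 * Num.sqrt al by rewrite /freq_hi /freq_lo; lra.
rewrite -(@ltr_pXn2r _ 2) ?nnegrE ?mulr_ge0 ?sqrtr_ge0 //.
by rewrite exprMn sbe sal; lra.
Qed.

Let half (x : R) : (Num.sqrt be * (x / 2) = (freq_hi * x + freq_lo * x) / 2) *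
  (Num.sqrt al * (x / 2) = (freq_hi * x - freq_lo * x) / 2).
Proof. by split; rewrite /freq_hi /freq_lo; field. Qed.

Lemma frame_detE x : frame_det T q x = sin (freq_hi * x) * sin (freq_lo * x) / q.
Proof.
rewrite /frame_det !cosm_ge0E ?(ltW be0) // !half.
move: (freq_hi * x) (freq_lo * x) => u v; congr (_ / q).
(* Here [s] and [t] are the half sum and half difference of [hi x] and [lo x]. *)
have prod s t : cos t ^+ 2 - cos s ^+ 2 = sin (s + t) * sin (s - t).
  rewrite sinD sinB.
  transitivity (sin s ^+ 2 * cos t ^+ 2 - cos s ^+ 2 * sin t ^+ 2); last by ring.
  by rewrite !sin2cos2; ring.
by rewrite prod; congr (sin _ * sin _); field.
Qed.

Lemma frame_det'E x : frame_det' T q x =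
  (freq_hi * cos (freq_hi * x) * sin (freq_lo * x)
   + freq_lo * sin (freq_hi * x) * cos (freq_lo * x)) / q.
Proof.
rewrite /frame_det' !mul_sinmE !cosm_ge0E ?(ltW be0) //.
rewrite !(@ler0_sqrtr _ (- _)) ?oppr_le0 ?(ltW be0) // !mul0r !subr0 !half.
have sbE : Num.sqrt be = freq_hi + freq_lo by rewrite /freq_hi /freq_lo; field.
have saE : Num.sqrt al = freq_hi - freq_lo by rewrite /freq_hi /freq_lo; field.
rewrite sbE saE.
move: freq_hi freq_lo => a b; move: (a * x) (b * x) => u v; congr (_ / q).
have prod s t : (a + b) * sin s * cos s - (a - b) * sin t * cos t =
    a * cos (s + t) * sin (s - t) + b * sin (s + t) * cos (s - t).
  rewrite sinB cosB sinD cosD.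
  transitivity ((a + b) * sin s * cos s * (cos t ^+ 2 + sin t ^+ 2)
      - (a - b) * sin t * cos t * (cos s ^+ 2 + sin s ^+ 2)); last by ring.
  by rewrite !cos2Dsin2 !mulr1.
by rewrite prod; congr (a * cos _ * sin _ + b * sin _ * cos _); field.
Qed.

End RealFrequencies.

(** For [al < 0] there is no zero. For [al = 0] the determinant is [be * sinm ^ 2 / q], all of whose
    zeros are double. *)
Lemma frame_det0_double x : al <= 0 -> 0 < x ->
  frame_det T q x = 0 -> frame_det' T q x = 0.
Proof.
rewrite le_eqVlt => /orP[/eqP al0 x0|al0 x0 fx0]; last first.
  by have := frame_det_gt0 x al0 x0; rewrite fx0 ltxx.
have ec := cosm2Dsinm2 be (x / 2).
rewrite /frame_det /frame_det' al0 !mul0r subr0 [cosm 0 _]cosm_ge0E // sqrtr0 mul0r cos0.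
move=> /eqP; rewrite mulf_eq0 invr_eq0 (gt_eqF q0) orbF expr1n subr_eq0 => /eqP c1.
move: ec; rewrite -c1 => /(canRL (addKr _)); rewrite addNr => /eqP.
rewrite mulf_eq0 sqrf_eq0 => /orP[/eqP ->|/eqP ->]; first by rewrite !mul0r.
by rewrite mulr0 !mul0r.
Qed.

End FrameDetSign.

Lemma sin_lt0_pi2 {R : realType} (y : R) : pi < y < 2 * pi -> sin y < 0.
Proof.
move=> /andP[y1 y2]; rewrite -(subrK pi y) sinDpi oppr_lt0 sin_gt0_pi //.
by apply/andP; split; lra.
Qed.

(* [(hi - lo)^2 = T - 2 q] decreases while [hi * lo = q] increases. *)
Lemma freq_mono {R : realType} (T q T' q' : R) :
  0 < q -> q < q' -> T' < T -> 0 <= T' - 2 * q' ->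
  freq_lo T q < freq_lo T' q' /\ freq_hi T' q' < freq_hi T q.
Proof.
move=> q0 qq' TT' al0'.
have q0' : 0 < q' by lra.
have al0 : 0 <= T - 2 * q by lra.
have := freq_mul T q q0 al0; have := freq_sqrD T q q0 al0.
have := freq_mul T' q' q0' al0'; have := freq_sqrD T' q' q0' al0'.
have := freq_lo_gt0 T q q0 al0; have := freq_lo_gt0 T' q' q0' al0'.
have := freq_lo_hi T q; have := freq_lo_hi T' q'.
move: (freq_lo T q) (freq_hi T q) (freq_lo T' q') (freq_hi T' q').
move=> b a b' a' ba' ba b0' b0 eT' eq' eT eq.
have bb' : b < b'.
  (* With [b' <= b], the larger product forces [a < a']; the gap between the frequencies would then
     widen, while [T - 2 * q] decreases. *)
  rewrite ltNge; apply/negP => b'b.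
  have aa' : a < a' by rewrite ltNge; apply/negP => a'a; nra.
  have : (a - b) ^+ 2 < (a' - b') ^+ 2 by rewrite ltr_pXn2r // ?nnegrE; lra.
  have : (a' - b') ^+ 2 < (a - b) ^+ 2 by nra.
  lra.
by split=> //; rewrite ltNge; apply/negP => aa'; nra.
Qed.

(** * Dependence of the trace and determinant of B on lam *)

Section Monotonicity.
Context {R : realType}.
Variables (A : 'M[R]_2) (d : R).
Hypotheses (hdet : 0 < \det A) (htr : \tr A < 0) (hd : 0 < d).

Lemma trB_lt lam mu : lam < mu -> trB A d mu < trB A d lam.
Proof.
move=> lm; rewrite /trB ltrD //; first by lra.
by rewrite ltr_pM2r ?invr_gt0 //; lra.
Qed.

Lemma sqrtdetB_lt lam mu : 0 <= lam -> lam < mu ->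
  sqrtdetB A d lam < sqrtdetB A d mu.
Proof.
move=> lam0 lm; rewrite ltr_sqrt; last by apply: detB_gt0 => //; lra.
rewrite ltr_pM2r ?invr_gt0 // ltrD2r; move: (\tr A) htr => t t0.
(* This product is the difference of the two numerators of [detB]. *)
have : 0 < (mu - lam) * (mu + lam - t) by rewrite mulr_gt0 //; lra.
by nra.
Qed.

Lemma trB_le lam mu : lam <= mu -> trB A d mu <= trB A d lam.
Proof. by rewrite le_eqVlt => /orP[/eqP ->//|/trB_lt/ltW]. Qed.

Lemma continuous_trB : continuous (trB A d).
Proof.
move=> lam; apply: cvgD; first by apply: cvgB; [exact: cvg_cst|exact: cvg_id].
by apply: cvgMl; apply: cvgB; [exact: cvg_cst|exact: cvg_id].
Qed.

Lemma continuous_sqrtdetB : continuous (sqrtdetB A d).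
Proof.
move=> lam; apply: (continuous_comp (f := detB A d)); last exact: sqrt_continuous.
apply: cvgMl; apply: cvgD; last exact: cvg_cst.
apply: cvgB; first exact: exprn_continuous.
by apply: cvgMl; exact: cvg_id.
Qed.

Lemma turing_trB :
  (A 1 1 + d * A 0 0 > 2 * Num.sqrt (d * \det A))
  = (0 < trB A d 0 - 2 * sqrtdetB A d 0).
Proof.
have -> : trB A d 0 = (A 1 1 + d * A 0 0) / d.
  by rewrite /trB; field; exact: lt0r_neq0.
have -> : sqrtdetB A d 0 = Num.sqrt (d * \det A) / d.
  rewrite /sqrtdetB /detB expr0n mul0r subr0 add0r.
  rewrite (_ : \det A / d = d * \det A / d ^+ 2); last first.
    by field; exact: lt0r_neq0.
  rewrite sqrtrM ?mulr_ge0 ?ltW // sqrtrV ?sqr_ge0 // sqrtr_sqr gtr0_norm //.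
by rewrite subr_gt0 mulrA ltr_pM2r ?invr_gt0.
Qed.

End Monotonicity.

(** * Degrees of loops *)

Lemma periodic_intmul {R : realType} (f : R -> R) (x : R) (k : int) :
  periodic f (pi *+ 2) -> f (x + k%:~R * (2 * pi)) = f x.
Proof.
move=> fper; rewrite mulr_natl; case: k => n.
  by rewrite -pmulrn mulr_natl (periodicn fper).
rewrite NegzE mulrNz -pmulrn mulNr mulr_natl.
by rewrite -[in RHS](subrK (pi *+ 2 *+ n.+1) x) (periodicn fper).
Qed.

Section Degree.
Context {R : realType}.

(** Explicit coordinates of the value of [tau]; in particular the value -1 is taken only when
    [x = 0]. *)
Lemma sqr_unit_conj (x y : R) : ((x -i* y) / `|x -i* y|)%C ^+ 2 =
  ((x ^+ 2 - y ^+ 2) / (x ^+ 2 + y ^+ 2) +i* - (2 * x * y / (x ^+ 2 + y ^+ 2)))%C.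
Proof.
have nE : (`|x -i* y|)%C ^+ 2 = ((x ^+ 2 + y ^+ 2)%:C)%C.
  rewrite normc_def /= -rmorphXn /= sqr_sqrtr ?addr_ge0 ?sqr_ge0 // sqrrN //.
rewrite expr_div_n nE -[X in X^-1]/(_%:C)%C -fmorphV /=.
by apply/eqP; rewrite eq_complex expr2 /=; apply/andP; split; apply/eqP; ring.
Qed.

(** A nonzero degree makes the argument vary by at least [2 * pi], so by the intermediate value
    theorem it meets an odd multiple of [pi], where the loop equals -1. *)
Lemma has_degree_eq0 (gamma : R -> R[i]) (n : int) :
  has_degree gamma n -> (forall t, t \in `[0, 4] -> gamma t != -1) -> n = 0.
Proof.
move=> [theta [ctheta gammaE theta4]] gammaN1.
apply/eqP; apply: contrapT => /negP n0.
have pi0 : 0 < pi :> R := pi_gt0 R.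
have [k kb] : exists k : int,
    Num.min (theta 0) (theta 4) <= pi + k%:~R * (2 * pi) <= Num.max (theta 0) (theta 4).
  set M := Num.max _ _; set m := Num.min _ _.
  have Mm : 2 * pi <= M - m.
    have -> : M - m = `|theta 4 - theta 0| by rewrite /M /m maxr_absE minr_absE distrC; field.
    have n1 : 1 <= `|n%:~R| :> R by rewrite -intr_norm (ler1z R) -gtz0_ge1 normr_gt0.
    have pi20 : 0 < 2 * pi :> R by rewrite mulr_gt0.
    by rewrite theta4 normrM (gtr0_norm pi20) ler_peMl // ltW.
  (* The largest [pi + 2 k pi] not exceeding [M]; it exceeds [M - 2 * pi], hence [m]. *)
  exists (Num.floor ((M - pi) / (2 * pi))).
  have /andP[] := floor_itv ((M - pi) / (2 * pi)).
  rewrite ler_pdivlMr ?mulr_gt0 // ltr_pdivrMr ?mulr_gt0 // intrD.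
  by move: (_%:~R) => k kl kr; apply/andP; split; lra.
have [t t04 thetat] := IVT (ler0n _ 4) ctheta kb.
case/eqP: (gammaN1 t t04); rewrite gammaE // thetat.
rewrite (periodic_intmul cos _ _ (@cosD2pi R)) (periodic_intmul sin _ _ (@sinD2pi R)) cospi sinpi.
by apply/eqP; rewrite eq_complex /= oppr0 !eqxx.
Qed.

(* The hypothesis keeps [(F, G)] away from the half-line opposite to
   [(sin Psi, cos Psi)], so that the angle between the two is a continuous
   function with values in ]-pi, pi[. *)
Lemma has_degree_lift (gamma : R -> R[i]) (F G Psi : R -> R) (n : int) :
  continuous F -> continuous G -> continuous Psi ->
  (forall t, 0 < F t * sin (Psi t) \/ 0 < G t * cos (Psi t)) ->
  (forall t, t \in `[0, 4] -> gamma t = ((F t -i* G t) / `|F t -i* G t|)%C ^+ 2) ->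
  F 4 = F 0 -> G 4 = G 0 -> Psi 4 - Psi 0 = n%:~R * (2 * pi) ->
  has_degree gamma (n *+ 2).
Proof.
move=> cF cG cPsi FGPsi gammaE F40 G40 Psi40.
(* [X] and [Y] are the components of [(F, G)] along [(sin Psi, cos Psi)] and along the orthogonal
   direction [(cos Psi, - sin Psi)]. *)
pose X t := F t * sin (Psi t) + G t * cos (Psi t).
pose Y t := F t * cos (Psi t) - G t * sin (Psi t).
pose rho t := Num.sqrt (F t ^+ 2 + G t ^+ 2).
have sc t := cos2Dsin2 (Psi t).
have rhoXY t : rho t ^+ 2 = X t ^+ 2 + Y t ^+ 2.
  rewrite sqr_sqrtr ?addr_ge0 ?sqr_ge0 //.
  transitivity ((F t ^+ 2 + G t ^+ 2) * (cos (Psi t) ^+ 2 + sin (Psi t) ^+ 2)).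
    by rewrite sc mulr1.
  by rewrite /X /Y; ring.
have rho2 t : rho t ^+ 2 = F t ^+ 2 + G t ^+ 2.
  by rewrite sqr_sqrtr ?addr_ge0 ?sqr_ge0.
have rho0 t : 0 < rho t.
  rewrite sqrtr_gt0 lt0r addr_ge0 ?sqr_ge0 // andbT paddr_eq0 ?sqr_ge0 // !sqrf_eq0.
  by apply/negP => /andP[/eqP F0 /eqP G0]; case: (FGPsi t); rewrite ?F0 ?G0 mul0r ltxx.
have rhoX t : 0 < rho t + X t.
  rewrite ltNge; apply/negP => rX.
  have Xr : X t = - rho t.
    have := sqr_ge0 (Y t); have := rhoXY t; have := rho0 t; nra.
  have Y0 : Y t = 0.
    by apply/eqP; rewrite -sqrf_eq0; have := rhoXY t; rewrite Xr sqrrN => ?; apply/eqP; lra.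
  have FE : F t = - rho t * sin (Psi t).
    transitivity (X t * sin (Psi t) + Y t * cos (Psi t)); last by rewrite Xr Y0; ring.
    transitivity (F t * (cos (Psi t) ^+ 2 + sin (Psi t) ^+ 2)); first by rewrite sc mulr1.
    by rewrite /X /Y; ring.
  have GE : G t = - rho t * cos (Psi t).
    transitivity (X t * cos (Psi t) - Y t * sin (Psi t)); last by rewrite Xr Y0; ring.
    transitivity (G t * (cos (Psi t) ^+ 2 + sin (Psi t) ^+ 2)); first by rewrite sc mulr1.
    by rewrite /X /Y; ring.
  have r0 := rho0 t.
  case: (FGPsi t); rewrite ?FE ?GE -mulrA -expr2.
    by have := sqr_ge0 (sin (Psi t)); nra.
  by have := sqr_ge0 (cos (Psi t)); nra.
(* The tangent of half the angle between the two vectors, so that [(F, G)] is [rho] times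
   [(sin zeta, cos zeta)]. *)
pose u t := Y t / (rho t + X t).
pose zeta t := Psi t + 2 * atan (u t).
have csin : continuous (fun t => sin (Psi t)).
  by move=> t; apply: continuous_comp; [exact: cPsi|exact: continuous_sin].
have ccos : continuous (fun t => cos (Psi t)).
  by move=> t; apply: continuous_comp; [exact: cPsi|exact: continuous_cos].
have cX : continuous X.
  by move=> t; apply: cvgD; apply: cvgM; [exact: cF|exact: csin|exact: cG|exact: ccos].
have cY : continuous Y.
  by move=> t; apply: cvgB; apply: cvgM; [exact: cF|exact: ccos|exact: cG|exact: csin].
have crho : continuous rho.
  move=> t; apply: (continuous_comp (f := fun t => F t ^+ 2 + G t ^+ 2)).
    apply: cvgD; [apply: (continuous_comp (f := F) (g := fun z => z ^+ 2))
                 |apply: (continuous_comp (f := G) (g := fun z => z ^+ 2))];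
      by [exact: cF|exact: cG|exact: exprn_continuous].
  exact: sqrt_continuous.
have cu : continuous u.
  move=> t; apply: cvgM; first exact: cY.
  apply: cvgV; first by rewrite lt0r_neq0.
  by apply: cvgD; [exact: crho|exact: cX].
have czeta : continuous zeta.
  move=> t; apply: cvgD; first exact: cPsi.
  apply: cvgMr; apply: (continuous_comp (f := u)); first exact: cu.
  exact: continuous_atan.
have oneDu2 t : 1 + u t ^+ 2 = 2 * rho t / (rho t + X t).
  transitivity ((rho t ^+ 2 + 2 * rho t * X t + (X t ^+ 2 + Y t ^+ 2))
                / (rho t + X t) ^+ 2).
    by rewrite /u; field; exact: lt0r_neq0.
  by rewrite -rhoXY; field; exact: lt0r_neq0.
have cosatan t : cos (2 * atan (u t)) = X t / rho t.
  rewrite mulrC mulr_natr cos_mulr2n cos_atan exprVn sqr_sqrtr ?addr_ge0 ?sqr_ge0 // oneDu2.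
  by rewrite -mulr_natl; field; rewrite !lt0r_neq0.
have sinatan t : sin (2 * atan (u t)) = Y t / rho t.
  have c0 : cos (atan (u t)) != 0.
    by rewrite cos_atan invr_eq0 sqrtr_eq0 -ltNge ltr_pwDl // sqr_ge0.
  rewrite mulrC mulr_natr sin_mulr2n -mulr_natl.
  have -> : sin (atan (u t)) = u t * cos (atan (u t)).
    by rewrite -{2}[u t]atanK /tan divfK.
  rewrite (_ : _ * (u t * _) = u t * cos (atan (u t)) ^+ 2); last by ring.
  rewrite cos_atan exprVn sqr_sqrtr ?addr_ge0 ?sqr_ge0 // oneDu2.
  by rewrite /u; field; rewrite !lt0r_neq0.
have sinz t : sin (zeta t) = F t / rho t.
  rewrite sinD cosatan sinatan.
  transitivity (F t * (cos (Psi t) ^+ 2 + sin (Psi t) ^+ 2) / rho t); last by rewrite sc mulr1.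
  by rewrite /X /Y; ring.
have cosz t : cos (zeta t) = G t / rho t.
  rewrite cosD cosatan sinatan.
  transitivity (G t * (cos (Psi t) ^+ 2 + sin (Psi t) ^+ 2) / rho t); last by rewrite sc mulr1.
  by rewrite /X /Y; ring.
(* [F - i G] is [- i * rho] times the unit vector of angle [zeta]; squaring doubles the angle and
   turns [- i] into -1, which accounts for the [pi]. *)
exists (fun t => zeta t *+ 2 + pi); split.
- apply: continuous_subspaceT => t; apply: cvgD; last exact: cvg_cst.
  by apply: cvgD; exact: czeta.
- move=> t t04; rewrite gammaE // sqr_unit_conj cosDpi sinDpi.
  rewrite cos_mulr2n sin_mulr2n sinz cosz.
  have r0 : rho t != 0 by rewrite lt0r_neq0.
  rewrite -rho2; congr (_ +i* _)%C; last by rewrite -mulr_natl; field.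
  have -> : F t ^+ 2 = rho t ^+ 2 - G t ^+ 2 by rewrite rho2 addrK.
  by rewrite -mulr_natl; field.
(* The correction [zeta - Psi] depends only on [F], [G] and [Psi] modulo [2 * pi], so it agrees at
   both ends. *)
- have -> : zeta 4 = Psi 4 + (zeta 0 - Psi 0).
    have P4 : Psi 4 = Psi 0 + n%:~R * (2 * pi) by rewrite -Psi40 addrC subrK.
    have sP : sin (Psi 4) = sin (Psi 0) by rewrite P4 (periodic_intmul sin _ _ (@sinD2pi R)).
    have cP : cos (Psi 4) = cos (Psi 0) by rewrite P4 (periodic_intmul cos _ _ (@cosD2pi R)).
    by rewrite /zeta /u /rho /Y /X F40 G40 sP cP [Psi 0 + _]addrC addrK.
  rewrite -[Psi 4](subrK (Psi 0)) Psi40 rmorphMn /=.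
  by move: (zeta 0) (Psi 0) => z p; rewrite !mulr2n; ring.
Qed.

End Degree.

(** * The boundary of the rectangle *)

Section Rectangle.
Context {R : realType}.
Implicit Types a b s t : R.

Definition clamp01 s : R := Num.max 0 (Num.min 1 s).

Lemma clamp01_le0 s : s <= 0 -> clamp01 s = 0.
Proof. by move=> s0; rewrite /clamp01 min_r ?max_l //; lra. Qed.

Lemma clamp01_id s : 0 <= s <= 1 -> clamp01 s = s.
Proof. by move=> /andP[s0 s1]; rewrite /clamp01 min_r // max_r. Qed.

Lemma clamp01_ge1 s : 1 <= s -> clamp01 s = 1.
Proof. by move=> s1; rewrite /clamp01 min_l // max_r. Qed.

Lemma clamp01_itv s : 0 <= clamp01 s <= 1.
Proof. by rewrite /clamp01 le_max lexx /= ge_max ler01 ge_min lexx. Qed.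

Lemma clamp01_ratio a b s : a < s <= b ->
  [/\ 0 < clamp01 ((s - a) / (b - a)), clamp01 ((s - a) / (b - a)) <= 1
    & s < b -> clamp01 ((s - a) / (b - a)) < 1].
Proof.
move=> /andP[as_ sb]; have ba : 0 < b - a by lra.
have r0 : 0 < (s - a) / (b - a) by rewrite divr_gt0 // subr_gt0.
have r1 : (s - a) / (b - a) <= 1 by rewrite ler_pdivrMr // mul1r lerD2r.
rewrite clamp01_id ?(ltW r0) //; split=> // sb'.
by rewrite ltr_pdivrMr // mul1r ltrD2r.
Qed.

Lemma continuous_clamp01 : continuous clamp01.
Proof.
move=> s; apply: continuous_max; first exact: cvg_cst.
by apply: continuous_min; [exact: cvg_cst|exact: cvg_id].
Qed.

Lemma continuous_clamp01_comp (f : R -> R) :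
  continuous f -> continuous (fun t => clamp01 (f t)).
Proof.
by move=> cf t; apply: (continuous_comp (f := f)); [exact: cf|exact: continuous_clamp01].
Qed.

(** Clamping extends the boundary path continuously to all real parameters, so that
    [has_degree_lift] applies with continuity and noncrossing on the whole line. *)
Definition rect_x (x1 x2 : R) t := x1 + (clamp01 t - clamp01 (t - 2)) * (x2 - x1).
Definition rect_lam (l : R) t := (clamp01 (t - 1) - clamp01 (t - 3)) * l.

Lemma rect_cases t x1 x2 l :
  [\/ t <= 1 /\ (rect_x x1 x2 t = x1 + clamp01 t * (x2 - x1) /\ rect_lam l t = 0),
      1 <= t <= 2 /\ (rect_x x1 x2 t = x2 /\ rect_lam l t = clamp01 (t - 1) * l),
      2 <= t <= 3 /\ (rect_x x1 x2 t = x2 - clamp01 (t - 2) * (x2 - x1) /\ rect_lam l t = l)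
    | 3 <= t /\ (rect_x x1 x2 t = x1 /\ rect_lam l t = (1 - clamp01 (t - 3)) * l)].
Proof.
rewrite /rect_x /rect_lam.
have [t1|/ltW t1] := leP t 1.
  have c1 : clamp01 (t - 1) = 0 by apply: clamp01_le0; lra.
  have c2 : clamp01 (t - 2) = 0 by apply: clamp01_le0; lra.
  have c3 : clamp01 (t - 3) = 0 by apply: clamp01_le0; lra.
  apply: Or41; rewrite c1 c2 c3; split=> //; split; ring.
have [t2|/ltW t2] := leP t 2.
  have c0 : clamp01 t = 1 by apply: clamp01_ge1; lra.
  have c2 : clamp01 (t - 2) = 0 by apply: clamp01_le0; lra.
  have c3 : clamp01 (t - 3) = 0 by apply: clamp01_le0; lra.
  apply: Or42; rewrite t1 c0 c2 c3; split=> //; split; ring.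
have [t3|/ltW t3] := leP t 3.
  have c0 : clamp01 t = 1 by apply: clamp01_ge1; lra.
  have c1 : clamp01 (t - 1) = 1 by apply: clamp01_ge1; lra.
  have c3 : clamp01 (t - 3) = 0 by apply: clamp01_le0; lra.
  apply: Or43; rewrite t2 c0 c1 c3; split=> //; split; ring.
have c0 : clamp01 t = 1 by apply: clamp01_ge1; lra.
have c1 : clamp01 (t - 1) = 1 by apply: clamp01_ge1; lra.
have c2 : clamp01 (t - 2) = 1 by apply: clamp01_ge1; lra.
apply: Or44; rewrite c0 c1 c2; split=> //; split; ring.
Qed.

Lemma rect_boundaryE x1 x2 l t : t \in `[0, 4] ->
  rect_boundary x1 x2 0 l t = (rect_x x1 x2 t, rect_lam l t).
Proof.
rewrite in_itv /= => /andP[t0 t4]; rewrite /rect_boundary /rect_x /rect_lam subr0.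
have [t1|/ltW t1] := leP t 1.
  have c0 : clamp01 t = t by apply: clamp01_id; apply/andP; split; lra.
  have c1 : clamp01 (t - 1) = 0 by apply: clamp01_le0; lra.
  have c2 : clamp01 (t - 2) = 0 by apply: clamp01_le0; lra.
  have c3 : clamp01 (t - 3) = 0 by apply: clamp01_le0; lra.
  by rewrite c0 c1 c2 c3; congr (_, _); ring.
have [t2|/ltW t2] := leP t 2.
  have c0 : clamp01 t = 1 by apply: clamp01_ge1; lra.
  have c1 : clamp01 (t - 1) = t - 1 by apply: clamp01_id; apply/andP; split; lra.
  have c2 : clamp01 (t - 2) = 0 by apply: clamp01_le0; lra.
  have c3 : clamp01 (t - 3) = 0 by apply: clamp01_le0; lra.
  by rewrite c0 c1 c2 c3; congr (_, _); ring.
have [t3|/ltW t3] := leP t 3.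
  have c0 : clamp01 t = 1 by apply: clamp01_ge1; lra.
  have c1 : clamp01 (t - 1) = 1 by apply: clamp01_ge1; lra.
  have c2 : clamp01 (t - 2) = t - 2 by apply: clamp01_id; apply/andP; split; lra.
  have c3 : clamp01 (t - 3) = 0 by apply: clamp01_le0; lra.
  by rewrite c0 c1 c2 c3; congr (_, _); ring.
have c0 : clamp01 t = 1 by apply: clamp01_ge1; lra.
have c1 : clamp01 (t - 1) = 1 by apply: clamp01_ge1; lra.
have c2 : clamp01 (t - 2) = 1 by apply: clamp01_ge1; lra.
have c3 : clamp01 (t - 3) = t - 3 by apply: clamp01_id; apply/andP; split; lra.
by rewrite c0 c1 c2 c3; congr (_, _); ring.
Qed.

Lemma rect_x_itv x1 x2 l t : x1 <= x2 -> 0 <= l ->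
  x1 <= rect_x x1 x2 t <= x2 /\ 0 <= rect_lam l t <= l.
Proof.
move=> x12 l0.
have := clamp01_itv t; have := clamp01_itv (t - 1).
have := clamp01_itv (t - 2); have := clamp01_itv (t - 3).
case: (rect_cases t x1 x2 l) => -[_ [-> ->]];
  move: (clamp01 _) (clamp01 _) (clamp01 _) (clamp01 _) =>
    a3 a2 a1 a0 /andP[? ?] /andP[? ?] /andP[? ?] /andP[? ?];
  split; apply/andP; split; nra.
Qed.

Lemma continuous_rect_x x1 x2 : continuous (rect_x x1 x2).
Proof.
move=> t; apply: cvgD; first exact: cvg_cst.
apply: cvgMl; apply: cvgB; first exact: continuous_clamp01.
apply: (continuous_clamp01_comp (fun s => s - 2)) => s.
by apply: cvgB; [exact: cvg_id|exact: cvg_cst].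
Qed.

Lemma continuous_rect_lam l : continuous (rect_lam l).
Proof.
have csub (c : R) : continuous (fun t => clamp01 (t - c)).
  apply: continuous_clamp01_comp => s.
  by apply: cvgB; [exact: cvg_id|exact: cvg_cst].
by move=> t; apply: cvgMl; apply: cvgB; exact: csub.
Qed.

End Rectangle.

(** * The frame along the boundary and the existence of admissible numbers *)

Section Index.
Context {R : realType}.
Variables (A : 'M[R]_2) (d : R).
Hypotheses (hdet : 0 < \det A) (htr : \tr A < 0) (hd : 0 < d).

Local Notation T := (trB A d).
Local Notation q := (sqrtdetB A d).
Local Notation al l := (T l - 2 * q l).
Local Notation hi l := (freq_hi (T l) (q l)).
Local Notation lo l := (freq_lo (T l) (q l)).
Local Notation fd l := (frame_det (T l) (q l)).
Local Notation fd' l := (frame_det' (T l) (q l)).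

Lemma al_lt (lam mu : R) : 0 <= lam -> lam < mu -> al mu < al lam.
Proof.
move=> lam0 lm.
by have := trB_lt A d hd _ _ lm; have := sqrtdetB_lt A d hdet htr hd _ _ lam0 lm; lra.
Qed.

Lemma al_le (lam mu : R) : 0 <= lam -> lam <= mu -> al mu <= al lam.
Proof. by move=> lam0; rewrite le_eqVlt => /orP[/eqP ->//|/(al_lt _ _ lam0)/ltW]. Qed.

Lemma freq_mono_lam (lam mu : R) : 0 <= lam -> lam < mu -> 0 <= al mu ->
  lo lam < lo mu /\ hi mu < hi lam.
Proof.
move=> lam0 lm; apply: freq_mono; first exact: sqrtdetB_gt0.
- exact: sqrtdetB_lt.
- exact: trB_lt.
Qed.

Lemma continuous_al : continuous (fun l => al l).
Proof.
move=> l; apply: cvgB; first exact: continuous_trB.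
by apply: cvgMr; exact: continuous_sqrtdetB.
Qed.

Lemma continuous_be : continuous (fun l => T l + 2 * q l).
Proof.
move=> l; apply: cvgD; first exact: continuous_trB.
by apply: cvgMr; exact: continuous_sqrtdetB.
Qed.

Lemma continuous_hi : continuous (fun l => hi l).
Proof.
move=> l; apply: cvgMl; apply: cvgD.
- apply: (continuous_comp (f := fun l => T l + 2 * q l)); first exact: continuous_be.
  exact: sqrt_continuous.
- apply: (continuous_comp (f := fun l => al l)); first exact: continuous_al.
  exact: sqrt_continuous.
Qed.

Lemma al_level (v : R) : 0 < v -> v < al 0 -> exists2 l, 0 < l & al l = v.
Proof.
move=> v0 v1.
have q00 : 0 < q 0 by exact: sqrtdetB_gt0.
have T00 : 0 <= T 0 by lra.
have qT : 0 < q (T 0) by exact: sqrtdetB_gt0.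
(* At [lam = T 0] the trace is nonpositive, so [al] is negative there and takes the value [v] in
   between. *)
have TT : T (T 0) <= 0.
  have -> : T (T 0) = - (T 0 / d) by rewrite {1}/trB /trB; field; exact: lt0r_neq0.
  by rewrite oppr_le0 divr_ge0 // ltW.
have cal : {within `[0, T 0], continuous (fun l => al l)}.
  by apply: continuous_subspaceT; exact: continuous_al.
have alT : al (T 0) <= al 0 by lra.
have [|l] := IVT (v := v) T00 cal.
  by rewrite min_r // max_l //; apply/andP; split; lra.
rewrite in_itv /= => /andP[l0 _] all; exists l => //.
by rewrite lt0r l0 andbT; apply/eqP => l00; move: all; rewrite l00; lra.
Qed.

(** As long as [sin (lo x)] is positive, [f] has the sign of [sin (hi x)], and where the latter
    vanishes [f'] has the sign of [cos (hi x)]. This lets the angle [hi x] follow [(f, f')]. *)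
Lemma frame_det_noncrossing (lam x : R) : 0 <= lam -> 0 <= al lam -> 0 < x ->
  0 < lo lam * x < pi ->
  0 < fd lam x * sin (hi lam * x) \/ 0 < fd' lam x * cos (hi lam * x).
Proof.
move=> lam0 al0 x0 lopi.
have q0 : 0 < q lam by exact: sqrtdetB_gt0.
rewrite frame_detE // frame_det'E //.
have slo := sin_gt0_pi lopi; have hi0 := freq_hi_gt0 _ _ q0 al0.
have [s0|s0] := eqVneq (sin (hi lam * x)) 0; [right|left].
  have c2 := cos2Dsin2 (hi lam * x); rewrite s0 expr0n addr0 in c2.
  rewrite s0 mulr0 mul0r addr0.
  rewrite (_ : _ * _ = hi lam * sin (lo lam * x) * cos (hi lam * x) ^+ 2 / q lam);
    last by ring.
  by rewrite c2 mulr1 divr_gt0 // mulr_gt0.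
rewrite (_ : _ * _ = sin (hi lam * x) ^+ 2 * sin (lo lam * x) / q lam); last by ring.
by rewrite divr_gt0 // mulr_gt0 // exprn_even_gt0.
Qed.

Lemma frame_det_gt0_small (lam x : R) : 0 <= lam -> 0 < x ->
  (0 <= al lam -> hi lam * x < pi) -> 0 < fd lam x.
Proof.
move=> lam0 x0 hix; have q0 : 0 < q lam by exact: sqrtdetB_gt0.
have [al0|al0] := leP 0 (al lam); last exact: frame_det_gt0.
have hx := hix al0; rewrite frame_detE //.
have lo0 := freq_lo_gt0 _ _ q0 al0; have lohi := freq_lo_hi (T lam) (q lam).
have lox : lo lam * x <= hi lam * x by rewrite ler_pM2r.
have lox0 : 0 < lo lam * x by rewrite mulr_gt0.
by rewrite divr_gt0 // mulr_gt0 // sin_gt0_pi //; apply/andP; split; lra.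
Qed.

Lemma frame_det_hi0 (lam : R) : 0 <= lam -> 0 <= al lam -> fd lam (pi / hi lam) = 0.
Proof.
move=> lam0 al0; have q0 : 0 < q lam by exact: sqrtdetB_gt0.
have h0 := freq_hi_gt0 _ _ q0 al0.
by rewrite frame_detE // (mulrC (hi lam) (pi / _)) divfK ?lt0r_neq0 // sinpi !mul0r.
Qed.

Lemma frame_det_lo0 (lam : R) : 0 <= lam -> 0 <= al lam -> fd lam (pi / lo lam) = 0.
Proof.
move=> lam0 al0; have q0 : 0 < q lam by exact: sqrtdetB_gt0.
have h0 := freq_lo_gt0 _ _ q0 al0.
by rewrite frame_detE // (mulrC (lo lam) (pi / _)) divfK ?lt0r_neq0 // sinpi mulr0 mul0r.
Qed.

Lemma continuous_frame (f l : R -> R) :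
  continuous f -> continuous l -> (forall t, 0 <= l t) ->
  continuous (fun t => fd (l t) (f t)) /\ continuous (fun t => fd' (l t) (f t)).
Proof.
move=> cf cl l0.
have ch : continuous (fun t => f t / 2) by move=> t; apply: cvgMl; exact: cf.
have cq : continuous (fun t => q (l t)).
  by move=> t; apply: (continuous_comp (f := l)); [exact: cl|exact: continuous_sqrtdetB].
have cqV : continuous (fun t => (q (l t))^-1).
  by move=> t; apply: cvgV; [rewrite lt0r_neq0 // sqrtdetB_gt0|exact: cq].
have cal : continuous (fun t => al (l t)).
  move=> t; apply: (continuous_comp (f := l) (g := fun l => al l)); first exact: cl.
  exact: continuous_al.
have cbe : continuous (fun t => T (l t) + 2 * q (l t)).
  move=> t; apply: (continuous_comp (f := l) (g := fun l => T l + 2 * q l)); first exact: cl.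
  exact: continuous_be.
have ca := continuous_cosm_comp _ _ _ cal ch; have cb := continuous_cosm_comp _ _ _ cbe ch.
have sa := continuous_mul_sinm_comp _ _ _ cal ch; have sb := continuous_mul_sinm_comp _ _ _ cbe ch.
split=> t; (apply: cvgM; last exact: cqV); apply: cvgB.
- rewrite expr2; apply: cvgM; exact: ca.
- rewrite expr2; apply: cvgM; exact: cb.
- by apply: cvgM; [exact: sb|exact: cb].
- by apply: cvgM; [exact: sa|exact: ca].
Qed.

Lemma admissible_exists (L : R) : 0 < L ->
  exists lam_inf delta : R, admissible A d L lam_inf delta.
Proof.
move=> L0; have T1 : 0 < 1 + `|T 0| by rewrite ltr_pwDl.
have Tabs : T 0 <= `|T 0| := ler_norm _.
(* Beyond [linf] the trace is nonpositive, hence [al < 0]. Also [hi ^ 2 <= T 0] gives [hi <= linf],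
   so [hi * x <= 1 < pi] for [x] up to [linf^-1]. *)
pose linf := 1 + `|T 0|.
pose delta := Num.min (L / 2) (linf^-1).
have delta0 : 0 < delta by rewrite lt_min divr_gt0 ?invr_gt0.
exists linf, delta; split=> //.
- move=> x lam /andP[x0 xL] lamge.
  have lam0 : 0 <= lam by rewrite (le_trans _ lamge) // ltW.
  apply/transversal_PD_W => //; apply/lt0r_neq0/frame_det_gt0 => //.
    exact: sqrtdetB_gt0.
  have q0 : 0 < q lam by exact: sqrtdetB_gt0.
  suff : T lam <= 0 by lra.
  have -> : T lam = T 0 - lam - lam / d by rewrite /trB; ring.
  have : 0 <= lam / d by rewrite divr_ge0 // ltW.
  by move: lamge; rewrite /linf; lra.
- by rewrite delta0 /= gt_min; apply/orP; left; lra.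
move=> x lam /andP[x0 xdelta] /andP[lam0 _].
apply/transversal_PD_W => //; apply/lt0r_neq0/frame_det_gt0_small => // al0.
have q0 : 0 < q lam by exact: sqrtdetB_gt0.
have h0 := freq_hi_gt0 _ _ q0 al0; have := freq_sqrD _ _ q0 al0.
have := trB_le A d hd _ _ lam0.
have xl : x * linf <= 1.
  rewrite -ler_pdivlMr // mul1r (le_trans xdelta) // ge_min lexx orbT //.
have pi2 := pi_ge2 R; have := sqr_ge0 (lo lam).
move: xl (normr_ge0 (T 0)); rewrite /linf.
move: (hi lam) (lo lam) h0 => a b a0; move: (T lam) (T 0) Tabs => t t0.
move: (`|t0|) => M t0M xM M0 b2 tt0 abt.
have aM : a <= 1 + M.
  rewrite leNgt; apply/negP => Ma.
  have : (1 + M) ^+ 2 < a ^+ 2 by rewrite ltr_pXn2r // ?nnegrE; lra.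
  by have := sqr_ge0 M; nra.
have : a * x <= (1 + M) * x by rewrite ler_pM2r.
by lra.
Qed.

End Index.

(** * The index *)

Lemma sinD2pi_mul {R : realType} (y : R) : sin (2 * pi + y) = sin y.
Proof. by rewrite mulr_natl addrC sinD2pi. Qed.

Section TuringIndex.
Context {R : realType}.
Variables (A : 'M[R]_2) (d : R).
Hypotheses (hdet : 0 < \det A) (htr : \tr A < 0) (hd : 0 < d).

Local Notation T := (trB A d).
Local Notation q := (sqrtdetB A d).
Local Notation al l := (T l - 2 * q l).
Local Notation hi l := (freq_hi (T l) (q l)).
Local Notation lo l := (freq_lo (T l) (q l)).
Local Notation fd l := (frame_det (T l) (q l)).
Local Notation fd' l := (frame_det' (T l) (q l)).

Lemma freq_mono_le (lam mu : R) : 0 <= lam -> lam <= mu -> 0 <= al mu ->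
  lo lam <= lo mu /\ hi mu <= hi lam.
Proof.
move=> lam0; rewrite le_eqVlt => /orP[/eqP -> //|lm al0].
by have [/ltW lolo /ltW hihi] := freq_mono_lam A d hdet htr hd _ _ lam0 lm al0.
Qed.

Lemma in_calM_frame (x lam : R) (psi : R) : 0 <= lam ->
  0 < fd lam x * sin psi \/ 0 < fd' lam x * cos psi -> in_calM (W A d x lam).
Proof.
move=> lam0 H; apply/in_calM_W => //; rewrite -negb_and.
by apply/negP => /andP[/eqP f0 /eqP f0']; case: H; rewrite ?f0 ?f0' mul0r ltxx.
Qed.

(** * Following the angle along the boundary, with the zero crossing at [ls] on the right side *)

Section Path.
Variables (l0 ls : R).
Hypotheses (l00 : 0 < l0) (l0s : l0 < ls) (als : 0 < al ls)
  (hi_l0 : hi l0 < 2 * lo l0).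

Local Notation L := (pi / lo ls).

Let ls0 : 0 < ls. Proof. exact: lt_trans l00 l0s. Qed.
Let qs0 : 0 < q ls. Proof. by apply: sqrtdetB_gt0 => //; exact: ltW. Qed.
Let los0 : 0 < lo ls. Proof. by apply: freq_lo_gt0 => //; exact: ltW. Qed.
Let L0 : 0 < L. Proof. by rewrite divr_gt0 // pi_gt0. Qed.
Let losL : lo ls * L = pi. Proof. by rewrite mulrC divfK // lt0r_neq0. Qed.

Lemma al_ge0_before l : 0 <= l -> l <= ls -> 0 <= al l.
Proof. by move=> l_0 lls; rewrite (le_trans (ltW als)) // al_le. Qed.

Lemma lo_before l : 0 <= l -> l < ls -> 0 < lo l < lo ls.
Proof.
move=> l_0 lls; have al0 := al_ge0_before l l_0 (ltW lls).
rewrite freq_lo_gt0 ?sqrtdetB_gt0 //=.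
by have [] := freq_mono_lam A d hdet htr hd _ _ l_0 lls (ltW als).
Qed.

(** With [lo ls * L = pi], the bounds come from [lo ls < hi l] and from
    [hi l <= hi l0 < 2 * lo l0 < 2 * lo ls]. *)
Lemma hi_window l : l0 <= l -> 0 <= al l -> lo ls < hi l -> pi < hi l * L < 2 * pi.
Proof.
move=> l0l al0 lohi; have [_ hihi] := freq_mono_le _ _ (ltW l00) l0l al0.
have /andP[_ lolo] := lo_before l0 (ltW l00) l0s.
move: (pi / lo ls) L0 losL => x x0 <-.
by rewrite mulrA; apply/andP; split; rewrite ltr_pM2r //; move: hi_l0; lra.
Qed.

Lemma hi_window_before l : l0 <= l -> l <= ls -> pi < hi l * L < 2 * pi.
Proof.
move=> l0l lls; have l_0 : 0 <= l by exact: le_trans (ltW l00) l0l.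
apply: hi_window => //; first exact: al_ge0_before.
have [_ hihi] := freq_mono_le _ _ l_0 lls (ltW als).
exact: lt_le_trans (freq_lo_hi_lt _ _ als) hihi.
Qed.

Lemma frame_det_before l : l0 <= l -> l < ls -> fd l L < 0.
Proof.
move=> l0l lls; have l_0 : 0 <= l by exact: le_trans (ltW l00) l0l.
have q0 : 0 < q l by exact: sqrtdetB_gt0.
have /andP[lo0 lolo] := lo_before l l_0 lls.
have slo : 0 < sin (lo l * L).
  apply: sin_gt0_pi; rewrite mulr_gt0 //=.
  by move: (pi / lo ls) L0 losL => x x0 <-; rewrite ltr_pM2r.
have shi := sin_lt0_pi2 _ (hi_window_before l l0l (ltW lls)).
rewrite frame_detE ?al_ge0_before ?(ltW lls) //.
by rewrite pmulr_llt0 ?invr_gt0 // pmulr_llt0.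
Qed.

(** At [ls] one has [lo L = pi], so only the term [- lo * sin (hi L)] survives, and [sin (hi L)] is
    negative. *)
Lemma frame_det'_at : 0 < fd' ls L.
Proof.
have := hi_window_before ls (ltW l0s) (lexx _) => /sin_lt0_pi2 shi.
rewrite frame_det'E ?(ltW als) // losL sinpi cospi mulr0 add0r mulrN1.
by rewrite divr_gt0 // oppr_gt0 pmulr_rlt0.
Qed.

(** While the frequencies are real, both [lo L] and [hi L] lie between [pi] and [2 * pi], and the
    product of two negative sines is positive. *)
Lemma frame_det_after l : ls < l -> 0 < fd l L.
Proof.
move=> lsl; have l_0 : 0 <= l by exact: ltW (lt_trans ls0 lsl).
have q0 : 0 < q l by exact: sqrtdetB_gt0.
have [al0|al0] := leP 0 (al l); last exact: frame_det_gt0.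
have [lolo hihi] := freq_mono_lam A d hdet htr hd _ _ (ltW ls0) lsl al0.
have lohi := freq_lo_hi (T l) (q l).
have lohi' : lo ls < hi l by lra.
have hw := hi_window l (ltW (lt_trans l0s lsl)) al0 lohi'.
have lw : pi < lo l * L < 2 * pi.
  have /andP[_ hw2] := hw; apply/andP; split; last first.
    by apply: le_lt_trans hw2; rewrite ler_pM2r.
  by move: (pi / lo ls) L0 losL => x x0 <-; rewrite ltr_pM2r.
rewrite frame_detE // divr_gt0 //.
by rewrite nmulr_lgt0 sin_lt0_pi2.
Qed.

Variables (li delta : R).
Hypothesis adm : admissible A d L li delta.

Let li0 : 0 < li. Proof. by case: adm. Qed.
Let delta0 : 0 < delta. Proof. by case: adm => _ _ /andP[]. Qed.
Let deltaL : delta < L. Proof. by case: adm => _ _ /andP[]. Qed.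

Let top_neq0 x lam : 0 < x <= L -> li <= lam -> fd lam x != 0.
Proof.
case: adm => _ H _ _ xL lil; apply/transversal_PD_W => //; last exact: H.
exact: le_trans (ltW li0) lil.
Qed.

Let left_neq0 x lam : 0 < x <= delta -> 0 <= lam <= li -> fd lam x != 0.
Proof.
by case: adm => _ _ _ H xL lil; apply/transversal_PD_W => //; [case/andP: lil|exact: H].
Qed.

(** [f] vanishes at [(L, ls)], which admissibility excludes from [li] on. *)
Lemma ls_lt_li : ls < li.
Proof.
rewrite ltNge; apply/negP => lils.
have : fd ls L != 0 by apply: top_neq0 => //; rewrite L0 lexx.
by rewrite frame_det_lo0 ?eqxx // ltW.
Qed.

(** Otherwise [lo li] would be real and larger than [lo ls], giving a zero of [f] at
    [pi / lo li < L] on the top side. *)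
Lemma al_li_lt0 : al li < 0.
Proof.
rewrite ltNge; apply/negP => al0.
have [lolo _] := freq_mono_lam A d hdet htr hd _ _ (ltW ls0) ls_lt_li al0.
have loi0 : 0 < lo li by exact: lt_trans los0 lolo.
have : fd li (pi / lo li) != 0.
  apply: top_neq0 => //; rewrite divr_gt0 ?pi_gt0 //=.
  by rewrite ler_pM2l ?pi_gt0 // lef_pV2 ?posrE // ltW.
by rewrite frame_det_lo0 ?eqxx // ltW.
Qed.

Lemma hi_delta lam : 0 <= lam <= li -> 0 <= al lam -> hi lam * delta < pi.
Proof.
move=> laml al0; have /andP[lam0 _] := laml.
have q0 : 0 < q lam by exact: sqrtdetB_gt0.
have h0 := freq_hi_gt0 _ _ q0 al0.
rewrite ltNge; apply/negP => pih.
have : fd lam (pi / hi lam) != 0.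
  by apply: left_neq0 => //; rewrite divr_gt0 ?pi_gt0 //= ler_pdivrMr // mulrC.
by rewrite frame_det_hi0 ?eqxx.
Qed.

Let r l := clamp01 ((l - l0) / (ls - l0)).
Let s l := clamp01 ((l - ls) / (li - ls)).
(** The comparison angle: [hi l * x] up to [l0], moved linearly to [2 * pi] between [l0] and [ls],
    then increased by the starting angle [hi 0 * delta] between [ls] and [li], which closes the turn
    exactly. *)
Let psi l x := (1 - r l) * (hi l * x) + r l * (2 * pi) + s l * (hi 0 * delta).

Let r_before l : l <= l0 -> r l = 0.
Proof.
by move=> ll0; rewrite /r clamp01_le0 // pmulr_lle0 ?invr_gt0 ?subr_gt0 // subr_le0.
Qed.

Let r_after l : ls <= l -> r l = 1.
Proof.
by move=> lls; rewrite /r clamp01_ge1 // ler_pdivlMr ?subr_gt0 // mul1r lerD2r.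
Qed.

Let s_before l : l <= ls -> s l = 0.
Proof.
move=> lls; have := ls_lt_li => lsli.
by rewrite /s clamp01_le0 // pmulr_lle0 ?invr_gt0 ?subr_gt0 // subr_le0.
Qed.

Let hi0_delta : 0 < hi 0 * delta < pi.
Proof.
have al0 : 0 <= al 0 by exact: al_ge0_before (ltW ls0).
rewrite hi_delta ?lexx ?(ltW li0) // andbT mulr_gt0 //.
by apply: freq_hi_gt0 => //; exact: sqrtdetB_gt0.
Qed.

Lemma psi_bottom x : 0 < x <= L ->
  0 < fd 0 x * sin (psi 0 x) \/ 0 < fd' 0 x * cos (psi 0 x).
Proof.
move=> /andP[x0 xL].
rewrite /psi r_before ?s_before ?(ltW ls0) ?(ltW l00) // subr0 mul1r !mul0r !addr0.
have /andP[lo0 lolo] := lo_before 0 (lexx _) ls0.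
apply: frame_det_noncrossing => //; first by apply: al_ge0_before => //; exact: ltW.
rewrite mulr_gt0 //=.
move: (pi / lo ls) L0 losL xL => y y0 <- xy.
apply: (@le_lt_trans _ _ (lo 0 * y)); first by rewrite ler_pM2l.
by rewrite ltr_pM2r.
Qed.

Lemma psi_right l : 0 <= l <= li ->
  0 < fd l L * sin (psi l L) \/ 0 < fd' l L * cos (psi l L).
Proof.
move=> /andP[l_0 lli]; rewrite /psi.
have [ll0|l0l] := leP l l0.
  have lls : l < ls by exact: le_lt_trans ll0 l0s.
  rewrite r_before // s_before ?(ltW lls) // subr0 mul1r !mul0r !addr0.
  have /andP[lo0 lolo] := lo_before l l_0 lls.
  apply: frame_det_noncrossing => //; first by apply: al_ge0_before => //; exact: ltW.
  rewrite mulr_gt0 //=.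
  by move: (pi / lo ls) L0 losL => x x0 <-; rewrite ltr_pM2r.
have [lls|lsl|->] := ltgtP l ls.
(* Before the crossing [f < 0], and [psi] lies between [hi l * L] and [2 * pi], where the sine is
   negative. *)
- left; rewrite s_before ?(ltW lls) // mul0r addr0.
  have := frame_det_before l (ltW l0l) lls => f0.
  have /andP[h1 h2] := hi_window_before l (ltW l0l) (ltW lls).
  rewrite nmulr_lgt0 //; apply: sin_lt0_pi2.
  have [r0 _ /(_ lls) r1] : [/\ 0 < r l, r l <= 1 & l < ls -> r l < 1].
    by apply: clamp01_ratio; rewrite l0l ltW.
  move: (r l) r0 r1 => rl r0 r1.
  move: h1 h2 (pi_gt0 R); move: (hi l * L) => h; move: (@pi R) => p h1 h2 p0.
  by apply/andP; split; nra.
(* After the crossing [f > 0], and [psi] exceeds [2 * pi] by at most [hi 0 * delta < pi]. *)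
- left; rewrite r_after ?(ltW lsl) // subrr mul0r add0r mul1r sinD2pi_mul.
  rewrite mulr_gt0 ?frame_det_after // sin_gt0_pi //.
  have [s0 s1 _] : [/\ 0 < s l, s l <= 1 & l < li -> s l < 1].
    by apply: clamp01_ratio; rewrite lsl.
  have /andP[h0 hpi] := hi0_delta.
  move: (s l) s0 s1 (hi 0 * delta) h0 hpi => sl s0 s1 h h0 hpi.
  by rewrite mulr_gt0 //=; nra.
- right; rewrite r_after ?lexx // s_before ?lexx // subrr !mul0r add0r addr0 mul1r.
  by rewrite mulr_natl cos2pi mulr1 frame_det'_at.
Qed.

Let psi_end x : psi li x = 2 * pi + hi 0 * delta.
Proof.
have lsli := ls_lt_li.
rewrite /psi r_after ?(ltW lsli) // subrr mul0r add0r mul1r.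
by rewrite /s divff ?subr_eq0 ?gt_eqF // clamp01_ge1 // mul1r.
Qed.

Lemma turing_has_index : has_index A d delta L 0 li 2.
Proof.
pose X t := rect_x delta L t; pose Lam t := rect_lam li t.
(* Neither argument goes back after [t = 2]: on the top and left sides [Psi] stays at
   [2 * pi + hi 0 * delta], whose sine is positive, as is [f] there. *)
pose Psi t := psi (clamp01 (t - 1) * li) (delta + clamp01 t * (L - delta)).
have lam_itv t : 0 <= Lam t <= li.
  by have [] := rect_x_itv delta L li t (ltW deltaL) (ltW li0).
have lam0 t : 0 <= Lam t by have /andP[] := lam_itv t.
have transv t : 0 < fd (Lam t) (X t) * sin (Psi t) \/ 0 < fd' (Lam t) (X t) * cos (Psi t).
  have [Xitv _] := rect_x_itv delta L li t (ltW deltaL) (ltW li0).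
  have spsi : 0 < sin (2 * pi + hi 0 * delta) by rewrite sinD2pi_mul sin_gt0_pi.
  have := Xitv; rewrite /Psi /X /Lam => /andP[X1 X2].
  have X0 : 0 < rect_x delta L t by exact: lt_le_trans delta0 X1.
  case: (rect_cases t delta L li) => -[tt [eX eL]].
  - rewrite eL (@clamp01_le0 _ (t - 1)) ?mul0r ?subr_le0 // eX.
    by apply: psi_bottom; rewrite -eX X0.
  - have /andP[t1 _] := tt; rewrite eX eL (@clamp01_ge1 _ t) // mul1r subrKC.
    by apply: psi_right; rewrite -eL; exact: lam_itv.
  - have /andP[t2 _] := tt; left.
    rewrite eL (@clamp01_ge1 _ (t - 1)) ?mul1r ?psi_end; last by lra.
    by rewrite mulr_gt0 // frame_det_gt0 ?al_li_lt0 // sqrtdetB_gt0 // ltW.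
  - left; rewrite (@clamp01_ge1 _ (t - 1)) ?mul1r ?psi_end; last by lra.
    rewrite mulr_gt0 // eX; apply: frame_det_gt0_small => // al0.
    by apply: hi_delta => //; exact: lam_itv.
have calM t : t \in `[0, 4] -> in_calM (W_boundary A d delta L 0 li t).
  move=> t04; rewrite /W_boundary rect_boundaryE //=.
  exact: in_calM_frame (transv t).
split=> //.
have cl1 : continuous (fun t : R => clamp01 (t - 1) * li).
  move=> t; apply: cvgMl; apply: (continuous_clamp01_comp (fun s => s - 1)) => z.
  by apply: cvgB; [exact: cvg_id|exact: cvg_cst].
have cxi : continuous (fun t : R => delta + clamp01 t * (L - delta)).
  move=> t; apply: cvgD; first exact: cvg_cst.
  by apply: cvgMl; exact: continuous_clamp01.
have cramp (c k : R) : continuous (fun t : R => clamp01 ((clamp01 (t - 1) * li - c) * k)).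
  apply: continuous_clamp01_comp => t; apply: cvgMl; apply: cvgB; first exact: cl1.
  exact: cvg_cst.
have cPsi : continuous Psi.
  move=> t; apply: cvgD; last by apply: cvgMl; exact: cramp.
  apply: cvgD; last by apply: cvgMl; exact: cramp.
  apply: cvgM; first by apply: cvgB; [exact: cvg_cst|exact: cramp].
  apply: cvgM; last exact: cxi.
  apply: (continuous_comp (f := fun t : R => clamp01 (t - 1) * li) (g := fun l => hi l));
    first exact: cl1.
  exact: continuous_hi.
have [cF cG] := continuous_frame A d hdet htr hd X Lam (continuous_rect_x delta L)
  (continuous_rect_lam li) lam0.
have c0 (z : R) : 0 <= z -> clamp01 (0 - z) = 0.
  by move=> z0; rewrite clamp01_le0 // sub0r oppr_le0.
have c1 (z : R) : z <= 3 -> clamp01 (4 - z) = 1.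
  by move=> z3; rewrite clamp01_ge1 //; lra.
have c00 : clamp01 0 = 0 :> R by rewrite clamp01_le0.
have c14 : clamp01 4 = 1 :> R by rewrite clamp01_ge1 //; lra.
have X40 : X 4 = X 0 by rewrite /X /rect_x c14 c00 c1 ?c0 ?subrr //; lra.
have Lam40 : Lam 4 = Lam 0 by rewrite /Lam /rect_lam !c1 ?c0 ?subrr //; lra.
apply: (has_degree_lift _ _ _ Psi 1 cF cG cPsi transv).
- move=> t t04; have := calM t t04; rewrite /= /W_boundary rect_boundaryE //=.
  exact: tau_phi_W.
- by rewrite X40 Lam40.
- by rewrite X40 Lam40.
- rewrite mul1r /Psi c1 ?mul1r ?psi_end; last by lra.
  rewrite c0 // c00 !mul0r addr0.
  rewrite /psi r_before ?s_before ?(ltW ls0) ?(ltW l00) //.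
  by rewrite subr0 mul1r !mul0r !addr0 addrK.
Qed.

End Path.

Lemma turing_index : 0 < al 0 -> exists2 L, 0 < L &
  forall li delta, admissible A d L li delta -> has_index A d delta L 0 li 2.
Proof.
move=> al0; have q00 : 0 < q 0 by exact: sqrtdetB_gt0.
(* The first bound makes [v] a value taken by [al]; the second gives [2 * al l0 < q l0], hence
   [hi l0 < 2 * lo l0]. The value [v / 2] at [ls] places [l0] before [ls]. *)
pose v := Num.min (al 0 / 2) (q 0 / 4).
have v0 : 0 < v by rewrite lt_min !divr_gt0.
have val : v < al 0.
  by rewrite (@le_lt_trans _ _ (al 0 / 2)) ?ge_min ?lexx //; lra.
have vq : v <= q 0 / 4 by rewrite ge_min lexx orbT.
have [l0 l00 all0] := al_level A d hdet htr hd v v0 val.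
have [ls ls0 alls] : exists2 l, 0 < l & al l = v / 2.
  by apply: al_level => //; lra.
have l0s : l0 < ls.
  rewrite ltNge; apply/negP => lsl0.
  by have := al_le A d hdet htr hd _ _ (ltW ls0) lsl0; lra.
have als : 0 < al ls by lra.
have ql0 := sqrtdetB_lt A d hdet htr hd 0 l0 (lexx _) l00.
have hilo : hi l0 < 2 * lo l0.
  by apply: freq_hi_lt2; lra.
exists (pi / lo ls); last by move=> li delta; exact: (turing_has_index l0 ls).
rewrite divr_gt0 ?pi_gt0 // freq_lo_gt0 ?ltW //.
by apply: sqrtdetB_gt0 => //; exact: ltW.
Qed.

(** The loop takes the value -1 only where [f = 0]; as [al] stays nonpositive, [f'] would vanish
    there too, contradicting membership in the domain of [phi]. *)
Lemma no_turing_index (x1 x2 li : R) (n : int) : al 0 <= 0 ->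
  0 < x1 -> x1 <= x2 -> 0 <= li -> has_index A d x1 x2 0 li n -> n = 0.
Proof.
move=> al0 x10 x12 li0 [calM deg]; apply: (has_degree_eq0 _ _ deg) => t t04.
have := calM t t04; rewrite /= /W_boundary rect_boundaryE //=.
have [/andP[X1 _] /andP[lam0 _]] := rect_x_itv x1 x2 li t x12 li0.
move: (rect_x x1 x2 t) (rect_lam li t) X1 lam0 => x lam x1x lam0 calMt.
rewrite tau_phi_W // sqr_unit_conj; apply/eqP => /(congr1 (@complex.Re R)) /= ReN1.
have x0 : 0 < x by exact: lt_le_trans x10 x1x.
have q0 : 0 < q lam by exact: sqrtdetB_gt0.
have allam : al lam <= 0 by rewrite (le_trans _ al0) // al_le.
have nz := (in_calM_W A d hdet htr hd x lam lam0).1 calMt.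
have f0 : fd lam x = 0.
  have den : fd lam x ^+ 2 + fd' lam x ^+ 2 != 0.
    rewrite paddr_eq0 ?sqr_ge0 // !sqrf_eq0 negb_and //.
  apply/eqP; rewrite -sqrf_eq0; apply/eqP.
  move: ReN1 => /(congr1 ( *%R^~ (fd lam x ^+ 2 + fd' lam x ^+ 2))).
  by rewrite divfK // => ?; lra.
by move: nz; rewrite f0 (frame_det0_double _ _ q0 x allam x0 f0) !eqxx.
Qed.

End TuringIndex.

Theorem theorem5p9 (R : realType) (A : 'M[R]_2) (d : R)
    (hdet : 0 < \det A) (htr : \tr A < 0) (hd : 0 < d) :
  (forall L : R, 0 < L -> exists lam_inf delta : R, admissible A d L lam_inf delta) /\
  (forall lam_inf delta : R -> R,
     (forall L : R, 0 < L -> admissible A d L (lam_inf L) (delta L)) ->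
     (A 1 1 + d * A 0 0 > 2 * Num.sqrt (d * \det A)
      <->
      exists L0 : R, 0 < L0 /\
        exists n : int, n != 0 /\
          has_index A d (delta L0) L0 0 (lam_inf L0) n)).
Proof.
split=> [L L0|li delta adm]; first exact: admissible_exists.
rewrite turing_trB //; split=> [al0|[L [L0 [n [n0 ind]]]]].
  have [L L0 index] := turing_index A d hdet htr hd al0.
  by exists L; split=> //; exists 2; split=> //; exact: index (adm L L0).
have [li0 _ /andP[delta0 deltaL] _] := adm L L0.
rewrite ltNge; apply: contra n0 => al0.
by rewrite (no_turing_index _ _ hdet htr hd _ _ _ n al0 delta0 (ltW deltaL) (ltW li0) ind).
Qed.
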